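(* Let $p$ be a prime and consider the points over $\mathbf C$, at the prime $p$, of the $\mathbf F_1$-arithmetic curve $(\operatorname{Spec}\mathbf Z)_{\mathbf F_1}$. For each place $v\in\Sigma_p=\{p,\infty\}$ let $\mathcal M_p^v$ be the space of non-trivial $\mathbf C$-points local at $v$, and let $W_\infty=\mathbf C^\times$, $W_p=\mathbf Q_p^\times$ be the local Weil groups. Then for each $v\in\Sigma_p$, the Frobenius action of $\mathbf N^\times$ on $\mathcal M_p^v$, $(w\cdot\rho)(t)=\rho(t)^w$, extends canonically to a well-defined continuous action of $W_v$ on $\mathcal M_p^v$, namely: - for $v=\infty$: every $\rho\in\mathcal M^\infty_p$ is of the form $\rho(t)=\exp(zt)$ for a unique $z\in\mathbf C^\times$, and $w\in\mathbf C^\times$ acts by $(w\cdot\rho)(t)=\exp(wzt)$; - for $v=p$: $w\in\mathbf Q_p^\times$ acts by $(w\cdot\rho)(t)=\tilde\rho(wt)$, where $\tilde\rho:\mathbf Q_p\to\mathbf C^\times$ is the unique continuous homomorphism extending $\rho$. Moreover, $\mathcal M_p^v$ is a principal homogeneous space under $W_v$ (a single, free $W_v$-orbit).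
   Context: Let $H_p=\mathbf Z[1/p]$ and $H_p^+=\{a\in \mathbf Z[1/p] : a\ge0\}$. The stalk at $p$ of the structure sheaf of the curve is the spherical monoid algebra $\mathbf F_1[T^{H_p^+}]$; its morphisms to the $\mathbf F_1$-algebra $H\mathbf C$ are the same as monoid homomorphisms $\rho:(H_p^+,+)\to(\mathbf C,\cdot)$ with $\rho(0)=1$. Such a point is local at $v\in\{p,\infty\}$ if it is continuous for the topology on $H_p^+$ induced by $H_p\subset\mathbf Q_v$ ($\mathbf Q_\infty=\mathbf R$) and the Euclidean topology on $\mathbf C$; it then takes values in $\mathbf C^\times$ and extends uniquely to a continuous homomorphism $\tilde\rho:\mathbf Q_v\to\mathbf C^\times$. It is non-trivial if it is not the constant map $1$. $\mathbf N^\times$ is the multiplicative monoid of positive integers, mapped to $W_v$ by the inclusions $\mathbf N^\times\subset\mathbf Q_p^\times$, $\mathbf N^\times\subset\mathbf C^\times$. The space $\mathcal M_p^v$ is topologized by uniform convergence of the extensions $\tilde\rho$ on compact subsets of $\mathbf Q_v$. *)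

(* Defs.v *)
From HB Require Import structures.
From mathcomp Require Import all_boot all_order all_algebra.
From mathcomp Require Import complex.
From mathcomp Require Import all_classical all_reals all_analysis.
From mathcomp Require Import ring_quotient generic_quotient ring lra.
Set Implicit Arguments.
Unset Strict Implicit.
Unset Printing Implicit Defensive.
Import Order.TTheory GRing.Theory Num.Theory.
Import numFieldNormedType.Exports.
Local Open Scope classical_set_scope.
Local Open Scope quotient_scope.
Local Open Scope ring_scope.

(* |x|_p = p ^ (v_p (denominator) - v_p (numerator)); its values are rational,
   so Q_p is metrised below with distances in rat rather than in R. *)
Definition padic_norm (p : nat) (x : rat) : rat :=
  if x == 0 then 0 else
  p%:R ^+ logn p `|denq x|%N / p%:R ^+ logn p `|numq x|%N.

Section PadicNorm.
Variables (p : nat) (p_pr : prime p).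
Local Notation N := (padic_norm p).
Implicit Types x y : rat.

Let P_gt0 k : 0 < p%:R ^+ k :> rat.
Proof. by rewrite exprn_gt0 // ltr0n prime_gt0. Qed.

Let P_neq0 k : p%:R ^+ k != 0 :> rat.
Proof. by rewrite gt_eqF. Qed.

Let intr_neq0 (a : int) : a != 0 -> a%:~R != 0 :> rat.
Proof. by rewrite intr_eq0. Qed.

Lemma padic_norm0 : N 0 = 0.
Proof. by rewrite /padic_norm eqxx. Qed.

Lemma padic_normE (a b : int) : a != 0 -> b != 0 ->
  N (a%:~R / b%:~R) = p%:R ^+ logn p `|b|%N / p%:R ^+ logn p `|a|%N.
Proof.
move=> a0 b0; set x : rat := a%:~R / b%:~R.
have x0 : x != 0 by rewrite mulf_neq0 ?invr_neq0 ?intr_neq0.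
have n0 : numq x != 0 by rewrite numq_eq0.
have d0 : denq x != 0 by exact: denq_neq0.
have e : (a * denq x = numq x * b)%R.
  apply: (@intr_inj rat); rewrite !intrM; apply/eqP.
  rewrite -eqr_div ?intr_neq0 //. by rewrite divq_num_den.
rewrite /padic_norm (negPf x0); apply/eqP.
rewrite eqr_div // -!exprD -!lognM ?absz_gt0 // -!abszM.
by rewrite (mulrC b) -e mulrC.
Qed.

Lemma padic_norm1 : N 1 = 1.
Proof. by rewrite -[X in N X]divr1 (@padic_normE 1 1) // divff. Qed.

Lemma padic_norm_gt0 x : (0 < N x) = (x != 0).
Proof.
rewrite /padic_norm; case: eqP => [_|_]; first by rewrite ltxx.
by rewrite divr_gt0.
Qed.

Lemma padic_norm_ge0 x : 0 <= N x.
Proof.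
have [->|x0] := eqVneq x 0; first by rewrite padic_norm0.
by rewrite ltW // padic_norm_gt0.
Qed.

Lemma padic_norm_eq0 x : (N x == 0) = (x == 0).
Proof.
have [->|x0] := eqVneq x 0; first by rewrite padic_norm0 eqxx.
by rewrite gt_eqF // padic_norm_gt0.
Qed.

Lemma padic_normM x y : N (x * y) = N x * N y.
Proof.
have [->|x0] := eqVneq x 0; first by rewrite mul0r padic_norm0 mul0r.
have [->|y0] := eqVneq y 0; first by rewrite mulr0 padic_norm0 mulr0.
rewrite -{1}[x]divq_num_den -{1}[y]divq_num_den mulf_div -!intrM.
have nx : numq x != 0 by rewrite numq_eq0.
have ny : numq y != 0 by rewrite numq_eq0.
rewrite padic_normE ?mulf_neq0 ?denq_neq0 //.
rewrite /padic_norm (negPf x0) (negPf y0) mulf_div -!exprD.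
by rewrite -!lognM ?absz_gt0 ?denq_neq0 // -!abszM.
Qed.

Lemma padic_normN x : N (- x) = N x.
Proof.
rewrite /padic_norm oppr_eq0; case: ifP => // _.
by rewrite numqN denqN abszN.
Qed.

Lemma padic_normB x y : N (x - y) = N (y - x).
Proof. by rewrite -padic_normN opprB. Qed.

Let padic_norm_int (a b d : int) : d != 0 ->
  N ((a + b)%:~R / d%:~R) <= Num.max (N (a%:~R / d%:~R)) (N (b%:~R / d%:~R)).
Proof.
move=> d0.
have [->|a0] := eqVneq a 0; first by rewrite add0r le_max lexx orbT.
have [->|b0] := eqVneq b 0; first by rewrite addr0 le_max lexx.
have [->|ab0] := eqVneq (a + b) 0.
  by rewrite mul0r padic_norm0 le_max padic_norm_ge0.
rewrite !padic_normE // le_max !ler_pM2l // !lef_pV2 ?posrE //.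
have p1 : 1 < p%:R :> rat by rewrite ltr1n prime_gt1.
have pd (c : int) n : c != 0 ->
    (n <= logn p `|c|)%N = ((p ^ n)%:Z %| c)%Z.
  by move=> c0; rewrite dvdzE absz_nat pfactor_dvdn // absz_gt0.
rewrite !ler_eXn2l // !pd //.
have [ab|/ltnW ba] := leqP (logn p `|a|%N) (logn p `|b|%N).
  by apply/orP; left; rewrite rpredD // -pd.
by apply/orP; right; rewrite rpredD // -pd.
Qed.

Lemma padic_normD x y : N (x + y) <= Num.max (N x) (N y).
Proof.
have h (z t : rat) : z = (numq z * denq t)%:~R / (denq z * denq t)%:~R.
  by rewrite !intrM -mulf_div divff ?intr_neq0 // mulr1 divq_num_den.
rewrite [x in N (x + _)](h x y) [x in N (_ + x)](h y x) (mulrC (denq y)).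
rewrite -mulrDl -intrD (le_trans (padic_norm_int _ _ _)) ?mulf_neq0 //.
by rewrite -h (mulrC (denq x)) -h.
Qed.

Lemma padic_norm_leD x y : N (x + y) <= N x + N y.
Proof.
by rewrite (le_trans (padic_normD x y)) // ge_max lerDl lerDr !padic_norm_ge0.
Qed.

Lemma padic_norm_isosceles x y : N (x - y) < N y -> N x = N y.
Proof.
move=> h; apply/eqP; rewrite eq_le; apply/andP; split.
  rewrite -{1}[x](subrK y) (le_trans (padic_normD _ _)) //.
  by rewrite ge_max lexx ltW.
rewrite leNgt; apply/negP => xy.
have := padic_normD (y - x) x; rewrite subrK leNgt padic_normB.
by rewrite gt_max h xy.
Qed.

Lemma padic_norm_dist x y : `|N x - N y| <= N (x - y).
Proof.
rewrite ler_norml lerBlDr lerNl opprB lerBlDr; apply/andP; split.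
  by rewrite padic_normB -{1}[y](subrK x) padic_norm_leD.
by rewrite -{1}[x](subrK y) padic_norm_leD.
Qed.
End PadicNorm.

(* Q_p is the completion of (rat, |.|_p): the ring of Cauchy sequences modulo
   the ideal of null sequences. *)
Section PadicNumbers.
Variables (p : nat) (p_pr : prime p).
Local Notation N := (padic_norm p).
Implicit Types u v : nat -> rat.

(* The unused primality argument lets the instances below be inferred. *)
Definition padic_cauchy (_ : prime p) : {pred nat -> rat} :=
  fun u => `[< forall e : rat, 0 < e -> exists n0, forall m n,
    (n0 <= m)%N -> (n0 <= n)%N -> N (u m - u n) < e >].

Lemma padic_cauchyP u : reflect (forall e : rat, 0 < e -> exists n0,
    forall m n, (n0 <= m)%N -> (n0 <= n)%N -> N (u m - u n) < e)
  (u \in padic_cauchy p_pr).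
Proof. exact: asboolP. Qed.

Lemma padic_cauchy_bounded u : u \in padic_cauchy p_pr ->
  exists (B : rat) n0, 0 < B /\ forall n, (n0 <= n)%N -> N (u n) <= B.
Proof.
move=> /padic_cauchyP/(_ 1 ltr01)[n0 h]; exists (N (u n0) + 1), n0; split.
  by rewrite ltr_wpDl ?padic_norm_ge0.
move=> n n0n; rewrite -[u n](addrNK (u n0)) addrC.
by rewrite (le_trans (padic_norm_leD p_pr _ _)) // lerD2l ltW // h.
Qed.

Lemma padic_cauchy_subring : subring_closed (padic_cauchy p_pr).
Proof.
split.
- apply/padic_cauchyP => e e0; exists 0%N => m n _ _.
  by rewrite subrr padic_norm0.
- move=> u v /padic_cauchyP uc /padic_cauchyP vc; apply/padic_cauchyP => e e0.
  have e2 : 0 < e / 2%:R by rewrite divr_gt0.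
  have [n1 h1] := uc _ e2; have [n2 h2] := vc _ e2.
  exists (maxn n1 n2) => m n; rewrite !geq_max => /andP[m1 m2] /andP[k1 k2].
  rewrite [X in N X](_ : _ = (u m - u n) - (v m - v n)); last first.
    change (u m - v m - (u n - v n) = (u m - u n) - (v m - v n)); ring.
  rewrite (le_lt_trans (padic_norm_leD p_pr _ _)) // padic_normN //.
  by rewrite [e]splitr ltrD ?h1 ?h2.
- move=> u v uC vC; apply/padic_cauchyP => e e0.
  have [A [n1 [A0 h1]]] := padic_cauchy_bounded uC.
  have [B [n2 [B0 h2]]] := padic_cauchy_bounded vC.
  have eA : 0 < e / 2%:R / A by rewrite !divr_gt0.
  have eB : 0 < e / 2%:R / B by rewrite !divr_gt0.
  move/padic_cauchyP: uC => /(_ _ eB) [n3 h3].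
  move/padic_cauchyP: vC => /(_ _ eA) [n4 h4].
  exists (maxn (maxn n1 n2) (maxn n3 n4)) => m n; rewrite !geq_max.
  move=> /andP[/andP[m1 m2] /andP[m3 m4]] /andP[/andP[k1 k2] /andP[k3 k4]].
  rewrite [X in N X](_ : _ = u m * (v m - v n) + (u m - u n) * v n); last first.
    change (u m * v m - u n * v n = u m * (v m - v n) + (u m - u n) * v n); ring.
  rewrite (le_lt_trans (padic_norm_leD p_pr _ _)) // !padic_normM //.
  rewrite [e]splitr ltrD //.
    apply: le_lt_trans (_ : A * N (v m - v n) < _).
      by rewrite ler_wpM2r ?padic_norm_ge0 ?h1.
    by rewrite mulrC -ltr_pdivlMr // h4.
  apply: le_lt_trans (_ : N (u m - u n) * B < _).
    by rewrite ler_wpM2l ?padic_norm_ge0 ?h2.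
  by rewrite -ltr_pdivlMr // h3.
Qed.

HB.instance Definition _ :=
  GRing.isSubringClosed.Build (nat -> rat) (padic_cauchy p_pr)
    padic_cauchy_subring.

Record padic_seq := PadicSeq
  { padic_seq_val :> nat -> rat; _ : padic_seq_val \in padic_cauchy p_pr }.

HB.instance Definition _ := [isSub for padic_seq_val].
HB.instance Definition _ := [Choice of padic_seq by <:].
HB.instance Definition _ :=
  [SubChoice_isSubComNzRing of padic_seq by <:].

Definition padic_null : {pred padic_seq} :=
  fun u : padic_seq => `[< forall e : rat, 0 < e -> exists n0, forall n,
    (n0 <= n)%N -> N (u n) < e >].

Lemma padic_nullP (u : padic_seq) : reflect (forall e : rat, 0 < e ->
    exists n0, forall n, (n0 <= n)%N -> N (u n) < e) (u \in padic_null).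
Proof. exact: asboolP. Qed.

Lemma padic_null_ideal : idealr_closed padic_null.
Proof.
split.
- by apply/padic_nullP => e e0; exists 0%N => n _; rewrite padic_norm0.
- apply/padic_nullP => /(_ 1 ltr01)[n0 /(_ _ (leqnn _))].
  by rewrite padic_norm1 // ltxx.
- move=> a u v /padic_nullP uN /padic_nullP vN; apply/padic_nullP => e e0.
  have [A [n1 [A0 h1]]] := padic_cauchy_bounded (valP a).
  have e2 : 0 < e / 2%:R by rewrite divr_gt0.
  have [n2 h2] := uN _ (divr_gt0 e2 A0); have [n3 h3] := vN _ e2.
  exists (maxn n1 (maxn n2 n3)) => n; rewrite !geq_max => /and3P[k1 k2 k3].
  rewrite (le_lt_trans (padic_norm_leD p_pr _ _)) // [e]splitr ltrD ?h3 //.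
  rewrite padic_normM //; apply: le_lt_trans (_ : A * N (u n) < _).
    by rewrite ler_wpM2r ?padic_norm_ge0 ?h1.
  by rewrite mulrC -ltr_pdivlMr // h2.
Qed.

HB.instance Definition _ := isIdealr.Build padic_seq padic_null padic_null_ideal.

Lemma padic_norm_stable (u : padic_seq) : u \notin padic_null ->
  exists (c : rat) n0, 0 < c /\ forall n, (n0 <= n)%N -> N (u n) = c.
Proof.
move=> uN; have [e [e0 he]] : exists e : rat, 0 < e /\
    forall n0, exists2 n, (n0 <= n)%N & e <= N (u n).
  apply: contrapT => H; move/negP: uN; apply; apply/padic_nullP => e e0.
  apply: contrapT => H'; apply: H; exists e; split=> // n0.
  apply: contrapT => H''; apply: H'; exists n0 => n n0n.
  by rewrite ltNge; apply/negP => en; apply: H''; exists n.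
have /padic_cauchyP/(_ e e0)[n0 h0] := valP u.
have [n n0n en] := he n0; exists (N (u n)), n0; split.
  exact: lt_le_trans en.
move=> m n0m; apply: padic_norm_isosceles => //.
exact: lt_le_trans (h0 _ _ n0m n0n) en.
Qed.

Definition Qp : Type := {ideal_quot padic_null}.
HB.instance Definition _ := EqQuotient.on Qp.
HB.instance Definition _ := GRing.ComNzRing.on Qp.

Implicit Types x y z : Qp.

(* The inverse is chosen classically; Qp_mulVf shows that it exists. *)
Definition Qp_inv x : Qp := xget 0 [set y | y * x = 1].

Definition Qp_of (u : padic_seq) : Qp := \pi_{ideal_quot padic_null} u.

Lemma Qp_of_zmod_morphism : zmod_morphism Qp_of.
Proof. by move=> u v; exact: (rmorphB \pi_{ideal_quot padic_null}). Qed.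

Lemma Qp_of_monoid_morphism : monoid_morphism Qp_of.
Proof.
split; first exact: (rmorph1 \pi_{ideal_quot padic_null}).
by move=> u v; exact: (rmorphM \pi_{ideal_quot padic_null}).
Qed.

HB.instance Definition _ :=
  GRing.isZmodMorphism.Build padic_seq Qp Qp_of Qp_of_zmod_morphism.
HB.instance Definition _ :=
  GRing.isMonoidMorphism.Build padic_seq Qp Qp_of Qp_of_monoid_morphism.

Definition Qp_repr (x : Qp) : padic_seq := repr x.

Lemma Qp_reprK : cancel Qp_repr Qp_of.
Proof. by move=> x; exact: reprK. Qed.

Lemma Qp_of_eq0 (u : padic_seq) : (Qp_of u == 0) = (u \in padic_null).
Proof.
rewrite -(rmorph0 Qp_of) -[u in RHS]subr0.
by rewrite (Quotient.idealrBE padic_null).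
Qed.

Lemma padic_inv_cauchy (u : padic_seq) : u \notin padic_null ->
  (fun n => (u n)^-1) \in padic_cauchy p_pr.
Proof.
move=> /padic_norm_stable[c [n0 [c0 h]]]; apply/padic_cauchyP => e e0.
have /padic_cauchyP/(_ (e * c * c))[|n1 h1] := valP u.
  by rewrite !mulr_gt0.
have u0 n : (n0 <= n)%N -> u n != 0.
  by move=> n0n; rewrite -(padic_norm_gt0 p_pr) h.
exists (maxn n0 n1) => m n; rewrite !geq_max => /andP[m0 m1] /andP[k0 k1].
rewrite [X in N X](_ : _ = (u n - u m) / u m / u n); last first.
  by field; rewrite !u0.
have Ninv k : (n0 <= k)%N -> N (u k)^-1 = c^-1.
  move=> k0'; apply: (mulfI (lt0r_neq0 c0)).
  rewrite -[in LHS](h k k0') -padic_normM // !divff ?u0 ?lt0r_neq0 //.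
  exact: padic_norm1.
by rewrite !padic_normM // !Ninv // !ltr_pdivrMr // h1.
Qed.

Lemma Qp_mulVf x : x != 0 -> Qp_inv x * x = 1.
Proof.
move=> x0; suff [y xy] : exists y, y * x = 1.
  by rewrite /Qp_inv; case: xgetP => [z _ //|/(_ y)].
set u := Qp_repr x; have uN : u \notin padic_null.
  by rewrite -Qp_of_eq0 Qp_reprK.
exists (Qp_of (PadicSeq (padic_inv_cauchy uN))).
rewrite -[x in LHS]Qp_reprK -rmorphM; apply/eqP.
rewrite -subr_eq0 -(rmorph1 Qp_of) -rmorphB Qp_of_eq0.
apply/padic_nullP => e e0.
have [c [n0 [c0 h]]] := padic_norm_stable uN; exists n0 => n n0n.
change (N ((u n)^-1 * u n - 1) < e).
rewrite mulVf -?(padic_norm_gt0 p_pr) ?h // subrr padic_norm0 //.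
Qed.

Lemma Qp_inv0 : Qp_inv 0 = 0.
Proof.
rewrite /Qp_inv; case: xgetP => // y _ /= /eqP.
by rewrite mulr0 eq_sym oner_eq0.
Qed.

HB.instance Definition _ := GRing.ComNzRing_isField.Build Qp Qp_mulVf Qp_inv0.

(* The limit of |x_n|_p along a representative (x_n) of x; Qp_normE shows that
   it exists and does not depend on the representative. *)
Definition Qp_norm x : rat :=
  xget 0 [set c : rat | forall e, 0 < e -> exists n0, forall n,
    (n0 <= n)%N -> `|N (Qp_repr x n) - c| < e].

Lemma Qp_norm_ex (u : padic_seq) : exists c : rat,
  forall e, 0 < e -> exists n0, forall n, (n0 <= n)%N -> `|N (u n) - c| < e.
Proof.
have [/padic_nullP uN|uN] := boolP (u \in padic_null).
  exists 0 => e /uN[n0 h]; exists n0 => n /h.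
  by rewrite subr0 ger0_norm ?padic_norm_ge0.
have [c [n0 [c0 h]]] := padic_norm_stable uN; exists c => e e0.
by exists n0 => n /h ->; rewrite subrr normr0.
Qed.

Lemma Qp_normE (u : padic_seq) e : 0 < e -> exists n0, forall n, (n0 <= n)%N ->
  `|N (u n) - Qp_norm (Qp_of u)| < e.
Proof.
set x := Qp_of u => e0.
have h : forall e : rat, 0 < e -> exists n0, forall n, (n0 <= n)%N ->
    `|N (Qp_repr x n) - Qp_norm x| < e.
  have [c hc] := Qp_norm_ex (Qp_repr x).
  by rewrite /Qp_norm; case: xgetP => [_ _ //|/(_ c)].
have /padic_nullP ux : u - Qp_repr x \in padic_null.
  by rewrite -Qp_of_eq0 rmorphB /= Qp_reprK subrr.
have e2 : 0 < e / 2%:R by rewrite divr_gt0.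
have [n1 h1] := h _ e2; have [n2 h2] := ux _ e2.
exists (maxn n1 n2) => n; rewrite geq_max => /andP[m1 m2].
rewrite [e]splitr (le_lt_trans (ler_distD (N (Qp_repr x n)) _ _)) //.
by rewrite ltrD ?h1 // (le_lt_trans (padic_norm_dist p_pr _ _)) // h2.
Qed.

Lemma Qp_normP (u : padic_seq) (c : rat) :
  (forall e, 0 < e -> exists n0, forall n, (n0 <= n)%N -> `|N (u n) - c| < e) ->
  Qp_norm (Qp_of u) = c.
Proof.
move=> h; apply/eqP; rewrite -subr_eq0 -normr_eq0 eq_le normr_ge0 andbT.
apply/ler_addgt0Pr => e e0; rewrite add0r.
have e2 : 0 < e / 2%:R by rewrite divr_gt0.
have [n1 h1] := h _ e2; have [n2 h2] := Qp_normE u e2.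
rewrite [e]splitr ltW // (le_lt_trans (ler_distD (N (u (maxn n1 n2))) _ _)) //.
by rewrite ltrD ?h1 ?leq_maxl // distrC h2 // leq_maxr.
Qed.

Lemma Qp_norm0 : Qp_norm 0 = 0.
Proof.
rewrite -(rmorph0 Qp_of); apply: Qp_normP => e e0; exists 0%N => n _.
by rewrite padic_norm0 subrr normr0.
Qed.

Lemma Qp_norm_eq0 x : Qp_norm x = 0 -> x = 0.
Proof.
rewrite -[x]Qp_reprK => h; apply/eqP; rewrite Qp_of_eq0.
apply/padic_nullP => e /(Qp_normE (Qp_repr x))[n0 hn]; exists n0 => n /hn.
by rewrite h subr0 ger0_norm ?padic_norm_ge0.
Qed.

Lemma Qp_normN x : Qp_norm (- x) = Qp_norm x.
Proof.
rewrite -[x]Qp_reprK -rmorphN; apply: Qp_normP => e /(Qp_normE (Qp_repr x)).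
by move=> [n0 h]; exists n0 => n /h; rewrite (@padic_normN p).
Qed.

Lemma Qp_norm_leD x y : Qp_norm (x + y) <= Qp_norm x + Qp_norm y.
Proof.
rewrite -[x]Qp_reprK -[y]Qp_reprK -rmorphD.
set u := Qp_repr x; set v := Qp_repr y.
apply/ler_addgt0Pr => e e0; have e3 : 0 < e / 3%:R by rewrite divr_gt0.
have [n1 h1] := Qp_normE u e3; have [n2 h2] := Qp_normE v e3.
have [n3 h3] := Qp_normE (u + v) e3; pose n := maxn n1 (maxn n2 n3).
have {h1} := h1 n (leq_maxl _ _); have {h2} := h2 n.
have {h3} := h3 n; rewrite !leq_max !leqnn !orbT => /(_ isT) + /(_ isT).
have : N ((u + v) n) <= N (u n) + N (v n) by exact: padic_norm_leD.
by rewrite !ltr_norml; lra.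
Qed.

Let dist x y := Qp_norm (x - y).

Let distxx x : dist x x = 0.
Proof. by rewrite /dist subrr Qp_norm0. Qed.

Let dist_eq0 x y : dist x y = 0 -> x = y.
Proof. by move=> /Qp_norm_eq0/eqP; rewrite subr_eq0 => /eqP. Qed.

Let dist_sym x y : dist x y = dist y x.
Proof. by rewrite /dist -Qp_normN opprB. Qed.

Let dist_triangle y x z : dist x z <= dist x y + dist y z.
Proof. by rewrite /dist -[x - z](subrKA y) Qp_norm_leD. Qed.

HB.instance Definition _ :=
  isMetric.Build rat Qp distxx dist_eq0 dist_sym dist_triangle.

End PadicNumbers.

(* Join of field and topological space, as for the library's
   PreTopologicalZmodule: no compatibility axiom, used only to quantify over
   R^o (the real line), R[i]^o (the complex numbers) and Q_p at once. *)
#[short(type="preTopologicalFieldType")]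
HB.structure Definition PreTopologicalField :=
  {F of GRing.Field F & Topological F}.

HB.instance Definition _ (F : numFieldType) := Topological.on F^o.
HB.instance Definition _ (F : numFieldType) := GRing.Field.on F^o.
HB.instance Definition _ (p : nat) (p_pr : prime p) := Topological.on (Qp p_pr).

(* F^*, with the topology induced by F. *)
Definition multGroup (F : fieldType) : Type := {x : F | x != 0}.

Section MultGroup.
Variable F : fieldType.
Implicit Types x y z : multGroup F.
HB.instance Definition _ := Choice.on (multGroup F).
HB.instance Definition _ := SubType.on (multGroup F).
Let one : multGroup F := Sub 1 (oner_neq0 F).
Let mul x y : multGroup F := Sub (val x * val y) (mulf_neq0 (valP x) (valP y)).
Let inv x : multGroup F := Sub (val x)^-1 (invr_neq0 (valP x)).
Let mulA : associative mul.
Proof. by move=> x y z; apply: val_inj; rewrite /= mulrA. Qed.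
Let mul1 : left_id one mul.
Proof. by move=> x; apply: val_inj; rewrite /= mul1r. Qed.
Let mul1' : right_id one mul.
Proof. by move=> x; apply: val_inj; rewrite /= mulr1. Qed.
Let mulV : left_inverse one inv mul.
Proof. by move=> x; apply: val_inj; rewrite /= mulVf ?(valP x). Qed.
Let mulV' : right_inverse one inv mul.
Proof. by move=> x; apply: val_inj; rewrite /= mulfV ?(valP x). Qed.
HB.instance Definition _ := isGroup.Build (multGroup F) mulA mul1 mul1' mulV mulV'.
End MultGroup.

HB.instance Definition _ (F : preTopologicalFieldType) :=
  Topological.copy (multGroup F) (initial_topology (\val : multGroup F -> F)).

Section Points.
Variables (R : realType) (p : nat) (p_pr : prime p).

(* H_p^+ as a predicate on rat (the primality argument is again a key). *)
Definition in_Hplus (_ : prime p) : {pred rat} := fun a =>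
  (0 <= a) && `[< exists (b : int) (n : nat), a = b%:~R / p%:R ^+ n >].

Lemma in_Hplus_addr : addr_closed (in_Hplus p_pr).
Proof.
split.
  by apply/andP; split=> //; apply/asboolP; exists 0, 0%N; rewrite mul0r.
move=> x y /andP[x0 /asboolP[a [n xE]]] /andP[y0 /asboolP[b [m yE]]].
apply/andP; split; first exact: addr_ge0.
apply/asboolP.
exists (a * p%:Z ^+ m + b * p%:Z ^+ n), (n + m)%N.
have pn k : p%:R ^+ k != 0 :> rat by rewrite expf_neq0 // pnatr_eq0 -lt0n prime_gt0.
rewrite xE yE rmorphD !rmorphM !rmorphXn /= exprD.
by field; rewrite !pn.
Qed.

Record Hplus := HPlus { Hplus_val :> rat; _ : Hplus_val \in in_Hplus p_pr }.

HB.instance Definition _ := [isSub for Hplus_val].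
HB.instance Definition _ := [Choice of Hplus by <:].
HB.instance Definition _ :=
  GRing.SubChoice_isSubNmodule.Build rat _ Hplus in_Hplus_addr.

Definition is_point (rho : Hplus -> R[i]^o) : Prop :=
  rho 0 = 1 /\ {morph rho : s t / s + t >-> s * t}.

Section Local.
Variable K : preTopologicalFieldType.

Definition Hplus_emb (t : Hplus) : K := ratr (Hplus_val t).

(* H_p^+ carries the topology induced by K, which is Q_p or R. *)
Definition local_at (rho : Hplus -> R[i]^o) : Prop :=
  continuous (rho : initial_topology Hplus_emb -> R[i]^o).

Definition localPoints : Type :=
  [set rho : Hplus -> R[i]^o | [/\ is_point rho, local_at rho & rho <> cst 1]].
HB.instance Definition _ := SubType.on localPoints.
HB.instance Definition _ := Choice.on localPoints.

Definition is_extension (rho : Hplus -> R[i]^o) (f : K -> R[i]^o) : Prop :=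
  [/\ forall x, f x != 0, {morph f : x y / x + y >-> x * y}, continuous f
     & forall t, f (Hplus_emb t) = rho t].

(* The continuous character of K extending rho; a default value is returned if
   there is none. Its existence and uniqueness are part of the theorem. *)
Definition extension (rho : localPoints) : K -> R[i]^o :=
  xget (cst 1) [set f | is_extension (val rho) f].

(* Uniform convergence of the extensions on compact subsets of K. *)
HB.instance Definition _ := Topological.copy localPoints
  (initial_topology
     (extension : localPoints -> {family compact, K -> R[i]^o})).

End Local.
End Points.

Definition continuous_action (F : preTopologicalFieldType) (X : topologicalType)
    (act : multGroup F -> X -> X) : Prop :=
  [/\ forall x, act 1%g x = x,
      forall u v x, act (u * v)%g x = act u (act v x)
    & continuous (fun ux : multGroup F * X => act ux.1 ux.2)].

Definition principal_homogeneous (F : fieldType) (X : Type)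
    (act : multGroup F -> X -> X) : Prop :=
  (exists x : X, True) /\ forall x y, exists! u, act u x = y.

Definition frobenius (R : realType) (p : nat) (p_pr : prime p) (n : nat)
    (rho : Hplus p_pr -> R[i]^o) : Hplus p_pr -> R[i]^o := fun t => rho t ^+ n.

(* The w below is the image of n under the inclusion of the positive integers
   in F^*. *)
Definition extends_frobenius (R : realType) (p : nat) (p_pr : prime p)
    (K : preTopologicalFieldType) (F : fieldType)
    (act : multGroup F -> localPoints R p_pr K -> localPoints R p_pr K) : Prop :=
  forall n, (0 < n)%N -> exists2 w : multGroup F, val w = n%:R &
    forall rho, val (act w rho) = frobenius n (val rho).

(* exp (x + iy) = e^x (cos y + i sin y) *)
Definition cexp (R : realType) (z : R[i]) : R[i]^o :=
  (expR (complex.Re z) * cos (complex.Im z)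
   +i* (expR (complex.Re z) * sin (complex.Im z)))%C.

(* Main.v *)
Require Import Defs.
From HB Require Import structures.
From mathcomp Require Import all_boot all_order all_algebra.
From mathcomp Require Import complex.
From mathcomp Require Import all_classical all_reals all_analysis.
From mathcomp Require Import ring lra.
Set Implicit Arguments.
Unset Strict Implicit.
Unset Printing Implicit Defensive.
Import Order.TTheory GRing.Theory Num.Theory.
Import numFieldNormedType.Exports.
Import ComplexField.Normc.
Local Open Scope classical_set_scope.
Local Open Scope ring_scope.

(** The theorem says that the non-trivial characters of the additive group of
    the local field K (R at infinity, Q_p at p) form a torsor under the Weil
    group, once a point local at v is identified with its continuous extension
    to K. In both cases a character is controlled by what it does near 0: a
    logarithm linearises it at infinity, while at p it is trivial there.

    At infinity, let rho be close to 1 on [0, p^-n]. There the principal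
    logarithm [clog] is defined, and it is additive along a point because the
    multiples of a small angle that stay in the right half-plane cannot wrap
    around the circle ([abs_natmul_lt_pihalf]); divisibility by p then gives
    rho(t) = exp(z t) ([real_point_exp]), with z unique ([expchar_inj]). The
    points are thus parametrised by C^*, the action is multiplication of
    exponents, and its continuity comes from that of z with respect to rho
    ([exponent_continuous]), together with the joint continuity of exp(z x).

    At p, the multiples of a small element are small, and C^* has no small
    subgroups ([no_small_subgroup]), so a local point is trivial on a ball
    around 0 ([point_locally_trivial]), and hence locally constant; by density
    of the non-negative elements of Z[1/p] it extends to Q_p
    ([locally_trivial_extension]). That the non-trivial characters form a
    single free orbit is the self-duality of Q_p. It is proved by hand: psi,
    the extension of t |-> exp(2 i pi t), is trivial on Z_p and sends p^-k to a
    primitive p^k-th root of unity ([standard_character]); if f is trivial on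
    Z_p then f(p^-k) is a p^k-th root of unity, that is psi(p^-k)^(a k), and the
    integers a k converge p-adically to the w such that f(x) = psi(w x)
    ([character_dual]).

    Continuity of the p-adic action is not a matter of estimates but of a ball:
    if the points near rho0 are all trivial on the same ball p^n Z_p, then
    rho(w x) = rho(w0 x) as soon as (w - w0) x lies in that ball. The topology
    only controls rho on compact sets, and the compact set used is
    {0, p^n, p^(n+1), ...}: a character close enough to 1 there is equal to 1
    at p^n ([character_near1]), because the values are roots of unity of order a
    power of p and the last one different from 1 would have order exactly p. *)

(** * Exponential and logarithm in the complex plane *)

Section Complex.
Variable R : realType.
Local Notation C := R[i]^o.
Implicit Types (z w u : C) (x y : R).

Lemma normcB z w : normc (z - w) = normc (w - z).
Proof. by rewrite -(normcN (z - w)) opprB. Qed.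

Lemma normc_ge0 z : 0 <= normc z.
Proof. by case: z => a b; rewrite sqrtr_ge0. Qed.

Lemma normc_eq0 z : (normc z == 0) = (z == 0).
Proof. by apply/eqP/eqP => [/eq0_normc//|->]; exact: normc0. Qed.

Lemma normcX z n : normc (z ^+ n) = normc z ^+ n.
Proof. by elim: n => [|n ih]; rewrite ?normc1 // !exprS normcM ih. Qed.

Lemma Re_le_normc z : `|complex.Re z| <= normc z.
Proof.
by case: z => a b /=; rewrite -sqrtr_sqr ler_wsqrtr// lerDl sqr_ge0.
Qed.

Lemma Im_le_normc z : `|complex.Im z| <= normc z.
Proof.
by case: z => a b /=; rewrite -sqrtr_sqr ler_wsqrtr// lerDr sqr_ge0.
Qed.

Lemma normc_le_ReIm z : normc z <= `|complex.Re z| + `|complex.Im z|.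
Proof.
case: z => a b /=.
rewrite -[leRHS]ger0_norm ?addr_ge0// -sqrtr_sqr ler_wsqrtr//.
rewrite sqrrD !real_normK ?num_real// lerD2r lerDl.
by rewrite mulrn_wge0// mulr_ge0.
Qed.

#[local] Instance nbhs_complex_filter (z : C) : Filter (nbhs z).
Proof. exact: nbhs_filter. Qed.

(** The radii of balls of R[i] are elements of R[i] that happen to be positive
    reals; this trades them for radii in R. *)
Lemma cvg_complexP (T : Type) (F : set_system T) {FF : Filter F} (f : T -> C) z :
  f @ F --> z <-> forall e, 0 < e -> \forall t \near F, normc (z - f t) < e.
Proof.
split=> [/cvgrPdist_lt fz e e0|fz].
  have := fz e%:C%C; rewrite ltcR => /(_ e0); apply: filterS => t.
  by rewrite /Num.norm /= ltcR.
apply/cvgrPdist_lt => -[e e']; rewrite ltcE /= => /andP[/eqP-> e0].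
by apply: filterS (fz e e0) => t; rewrite -ltcR.
Qed.

Lemma near_normc z e : 0 < e -> \forall w \near z, normc (z - w) < e.
Proof. by move=> e0; apply: (@cvg_complexP C (nbhs z) (nbhs_filter z) id z).1. Qed.

Lemma cvg_ReIm (T : Type) (F : set_system T) {FF : Filter F} (f : T -> C) z :
  (fun t => complex.Re (f t)) @ F --> complex.Re z ->
  (fun t => complex.Im (f t)) @ F --> complex.Im z -> f @ F --> z.
Proof.
move=> /cvgrPdist_lt fr /cvgrPdist_lt fi; apply/cvg_complexP => e e0.
have e2 : 0 < e / 2 by rewrite divr_gt0.
near=> t; rewrite (le_lt_trans (normc_le_ReIm _))//.
have {1}-> : complex.Re (z - f t) = complex.Re z - complex.Re (f t).
  by case: (z) (f t) => ? ? [].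
have -> : complex.Im (z - f t) = complex.Im z - complex.Im (f t).
  by case: (z) (f t) => ? ? [].
by rewrite [e]splitr ltrD//; near: t; [exact: fr|exact: fi].
Unshelve. all: by end_near. Qed.

Lemma continuous_Re : continuous (@complex.Re R : C -> R^o).
Proof.
move=> z; apply/cvgrPdist_lt => e e0.
apply: filterS (near_normc z e0) => w; apply: le_lt_trans.
by rewrite (le_trans _ (Re_le_normc _))//; case: (z) (w) => ? ? [].
Qed.

Lemma continuous_Im : continuous (@complex.Im R : C -> R^o).
Proof.
move=> z; apply/cvgrPdist_lt => e e0.
apply: filterS (near_normc z e0) => w; apply: le_lt_trans.
by rewrite (le_trans _ (Im_le_normc _))//; case: (z) (w) => ? ? [].
Qed.

Lemma normc_cexp z : normc (cexp z) = expR (complex.Re z).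
Proof.
rewrite /cexp /= !exprMn -mulrDr cos2Dsin2 mulr1 sqrtr_sqr.
by rewrite ger0_norm ?expR_ge0.
Qed.

Lemma cexp0 : cexp (0 : C) = 1.
Proof. by rewrite /cexp /= expR0 cos0 sin0 mulr1 mulr0. Qed.

Lemma cexpD z w : cexp (z + w) = cexp z * cexp w.
Proof.
case: z w => a b [c d]; apply/eqP.
by rewrite eq_complex /= expRD cosD sinD; apply/andP; split; apply/eqP; ring.
Qed.

Lemma cexp_neq0 z : cexp z != 0.
Proof. by rewrite -normc_eq0 normc_cexp gt_eqF ?expR_gt0. Qed.

Lemma cexpMn n z : cexp (n%:R * z) = cexp z ^+ n.
Proof.
elim: n => [|n ih]; first by rewrite mul0r cexp0.
by rewrite -natr1 mulrDl mul1r cexpD ih exprSr.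
Qed.

Lemma continuous_cexp : continuous (@cexp R : C -> C).
Proof.
move=> z.
have er : (expR (complex.Re w)) @[w --> z] --> expR (complex.Re z).
  by apply: continuous_comp; [exact: continuous_Re|exact: continuous_expR].
apply: cvg_ReIm => /=.
- apply: cvgM; first exact: er.
  by apply: (continuous_comp (@continuous_Im z)); exact: continuous_cos.
- apply: cvgM; first exact: er.
  by apply: (continuous_comp (@continuous_Im z)); exact: continuous_sin.
Qed.

Lemma abs_lt_pihalf x : `|x| < pi -> 0 < cos x -> `|x| < pi / 2.
Proof.
rewrite -(cos_norm x) => xpi; apply: contraTT; rewrite -!leNgt => xge.
rewrite -[`|x|](subrK pi) cosDpi oppr_le0 cos_ge0_pihalf//.
by move: xpi xge; set t := `|x|; lra.
Qed.

(** Multiples of an angle shorter than a quarter turn cannot jump over the left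
    half-plane: if they all lie in the right one, they have not wrapped around
    the circle. *)
Lemma abs_natmul_lt_pihalf x n : `|x| < pi / 2 ->
  (forall j, (j <= n)%N -> 0 < cos (j%:R * x)) -> `|n%:R * x| < pi / 2.
Proof.
move=> x0; elim: n => [_|n ih cos_gt0].
  by rewrite mul0r normr0 divr_gt0 ?pi_gt0.
apply: abs_lt_pihalf; last exact: cos_gt0.
have {}ih := ih (fun j jn => cos_gt0 j (leqW jn)).
rewrite -natr1 mulrDl mul1r (le_lt_trans (ler_normD _ _))//.
by rewrite [ltRHS]splitr ltrD.
Qed.

(** The principal logarithm. The arctangent gives the argument only in the
    half-plane where the real part is positive, which is the only place where
    it is used. *)
Definition clog z : C :=
  (ln (normc z) +i* atan (complex.Im z / complex.Re z))%C.

Lemma clogK z : 0 < complex.Re z -> cexp (clog z) = z.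
Proof.
case: z => a b /= a0; have n0 : 0 < Num.sqrt (a ^+ 2 + b ^+ 2).
  by rewrite sqrtr_gt0 ltr_pwDl ?sqr_ge0 ?exprn_gt0.
have c0 : Num.sqrt (a ^+ 2 + b ^+ 2) = a * Num.sqrt (1 + (b / a) ^+ 2).
  rewrite -{2}[a]ger0_norm ?ltW// -sqrtr_sqr -sqrtrM ?sqr_ge0//.
  by congr Num.sqrt; field; rewrite gt_eqF.
have s0 : Num.sqrt (1 + (b / a) ^+ 2) != 0.
  by rewrite gt_eqF// sqrtr_gt0 ltr_pwDl ?sqr_ge0.
have sE : sin (atan (b / a)) = (b / a) * cos (atan (b / a)).
  by rewrite -{2}[b / a]atanK /tan divfK// cos_atan invr_eq0.
rewrite /cexp /= lnK ?posrE// sE cos_atan c0 mulfK//; congr Complex.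
by field; rewrite s0 gt_eqF.
Qed.

Lemma Im_clog z : `|complex.Im (clog z)| < pi / 2.
Proof. by rewrite /clog /= ltr_norml atan_gtNpi2 atan_ltpi2. Qed.

Lemma cexpK z : `|complex.Im z| < pi / 2 -> clog (cexp z) = z.
Proof.
rewrite ltr_norml => zi; rewrite /clog normc_cexp expRK /cexp /=.
rewrite -mulf_div divff ?gt_eqF ?expR_gt0// mul1r -/(tan _) tanK//.
by case: (z).
Qed.

Lemma continuous_clog z : 0 < complex.Re z -> {for z, continuous clog}.
Proof.
move=> z0; apply: cvg_ReIm => /=.
  apply: (@continuous_comp C R^o R^o); last first.
    apply: continuous_ln; rewrite lt_neqAle eq_sym normc_eq0 normc_ge0 andbT.
    by apply: contraTneq z0 => ->; rewrite ltxx.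
  apply/cvgrPdist_lt => e e0.
  apply: filterS (near_normc z e0) => w; apply: le_lt_trans.
  rewrite ler_norml; apply/andP; split.
    by rewrite normcB lerNl opprB lerBlDr -{1}[w](subrK z) le_normcD.
  by rewrite lerBlDr -{1}[z](subrK w) le_normcD.
apply: (@continuous_comp C R^o R^o); last exact: continuous_atan.
apply: cvgM; first exact: continuous_Im.
by apply: cvgV; [rewrite gt_eqF|exact: continuous_Re].
Qed.

Lemma clog1 : clog 1 = 0.
Proof. by rewrite /clog normc1 ln1 /= mul0r atan0. Qed.

Lemma Re_gt0_near1 z : normc (z - 1) < 1 -> 0 < complex.Re z.
Proof.
move=> z1; have := le_lt_trans (Re_le_normc _) z1.
have -> : complex.Re (z - 1) = complex.Re z - 1 by case: (z) => a b.
by rewrite ltr_norml => /andP[]; rewrite ltrBrDr addNr.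
Qed.

(** Since z^2 - 1 = (z - 1)(z + 1), with |z + 1| >= 3/2 when |z - 1| <= 1/2,
    each squaring multiplies the distance to 1 by at least 3/2. *)
Lemma no_small_subgroup z :
  (forall n, normc (z ^+ n - 1) <= 2^-1) -> z = 1.
Proof.
move=> small; have grow m : (3 / 2) ^+ m * normc (z - 1) <= normc (z ^+ (2 ^ m) - 1).
  elim: m => [|m ih]; first by rewrite expr0 mul1r expr1.
  rewrite exprSr mulrAC expnSr exprM.
  have -> : (z ^+ (2 ^ m)) ^+ 2 - 1 = (z ^+ (2 ^ m) - 1) * (z ^+ (2 ^ m) + 1) by ring.
  rewrite normcM ler_pM ?mulr_ge0 ?exprn_ge0 ?normc_ge0//.
  have := le_normcD (z ^+ (2 ^ m) + 1) (1 - z ^+ (2 ^ m)).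
  rewrite (_ : _ + _ = 2%:R); last by ring.
  have -> : normc (2%:R : C) = 2.
    by rewrite normcMn normc1.
  have := small (2 ^ m)%N; rewrite (normcB 1).
  by set a := normc _; set b := normc _; lra.
apply/eqP; rewrite -subr_eq0 -normc_eq0 eq_le normc_ge0 andbT leNgt.
apply/negP => z1.
have [m mz] : exists m, (normc (z - 1))^-1 < (3 / 2 : R) ^+ m.
  have cv : (fun n => (2 / 3 : R) ^+ n) @ \oo --> (0 : R).
    by apply: cvg_expr; rewrite ger0_norm; lra.
  move/cvgrPdist_lt/(_ _ z1) : cv => [m _ /(_ m (leqnn m))] /=.
  rewrite sub0r normrN ger0_norm ?exprn_ge0// => h; exists m.
  rewrite (_ : 3 / 2 = (2 / 3)^-1); last by rewrite invf_div.
  by rewrite exprVn ltf_pV2// posrE exprn_gt0.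
move: mz; rewrite -(ltr_pM2r z1) mulVf ?gt_eqF// => mz.
by have := le_trans (grow m) (small _); lra.
Qed.

End Complex.

(** * Points, their extensions, and their topology *)

Section Points.
Variables (R : realType) (p : nat) (p_pr : prime p) (K : preTopologicalFieldType).
Local Notation C := R[i]^o.
Local Notation emb := (Hplus_emb (p_pr := p_pr) K).
Local Notation points := (localPoints R p_pr K).

Lemma entourage_normc (E : set (C * C)) : entourage E <->
  exists2 e : R, 0 < e & forall z w, normc (z - w) < e -> E (z, w).
Proof.
rewrite -entourage_ballE; split.
  move=> [[e e']] /=; rewrite ltcE /= => /andP[/eqP-> e0] eE.
  by exists e => // z w zw; apply: eE => /=; rewrite -ball_normE /= -ltcR in zw *.
move=> [e e0 eE]; exists (e%:C)%C => /=; first by rewrite ltcR.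
by move=> [z w] /=; rewrite -ball_normE /= => zw; apply: eE; rewrite -ltcR.
Qed.

(** This and [cvg_points] are the two directions in which the topology of
    uniform convergence on compact sets is used, with radii in R. *)
Lemma near_points (rho : points) (A : set K) (e : R) : compact A -> 0 < e ->
  \forall rho' \near rho,
    forall x, A x -> normc (extension rho x - extension rho' x) < e.
Proof.
move=> cA e0.
have cont := @initial_continuous points {family compact, K -> C}
  (@extension R p p_pr K) rho.
have eE : entourage [set zw : C * C | normc (zw.1 - zw.2) < e].
  by apply/entourage_normc; exists e.
exact: (cont _ (@fam_nbhs K C compact A _ (extension rho) eE cA)).
Qed.

Lemma cvg_points (T : Type) (F : set_system T) {FF : Filter F}
    (h : T -> points) (rho : points) :
  (forall (A : set K) (e : R), compact A -> 0 < e -> \forall t \near F,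
     forall x, A x -> normc (extension rho x - extension (h t) x) < e) ->
  h @ F --> rho.
Proof.
move=> cvh.
have : {family compact, (@extension R p p_pr K \o h) @ F --> extension rho}.
  apply/fam_cvgP => A cA P /uniform_nbhs[E [/entourage_normc[e e0 eE] EP]].
  by apply: filterS (cvh A e cA e0) => t te; apply: EP => x Ax; exact/eE/te.
move=> cv P [B [[U oU <-]] Urho /filterS]; apply.
by apply: cv; apply: open_nbhs_nbhs.
Qed.

Lemma character0 (f : K -> C) : (forall x, f x != 0) ->
  {morph f : x y / x + y >-> x * y} -> f 0 = 1.
Proof.
move=> f0 fD; apply: (mulfI (f0 0)); rewrite -fD addr0.
by rewrite mulr1.
Qed.

Lemma characterN (f : K -> C) x : (forall x, f x != 0) ->
  {morph f : x y / x + y >-> x * y} -> f (- x) = (f x)^-1.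
Proof.
move=> f0 fD; apply: (mulfI (f0 x)); rewrite -fD subrr character0//.
by rewrite mulfV.
Qed.

Lemma character_natmul (f : K -> C) n x : (forall x, f x != 0) ->
  {morph f : x y / x + y >-> x * y} -> f (n%:R * x) = f x ^+ n.
Proof.
move=> f0 fD; elim: n => [|n ih]; first by rewrite mul0r character0.
by rewrite -natr1 mulrDl mul1r fD ih exprSr.
Qed.

Lemma pointP (rho : points) :
  [/\ is_point (val rho), local_at K (val rho) & val rho <> cst 1].
Proof. by have := valP rho; rewrite inE. Qed.

Lemma local_near (rho : points) s (e : R) : 0 < e ->
  exists2 B, nbhs (emb s) B &
    forall t, B (emb t) -> normc (val rho s - val rho t) < e.
Proof.
move=> e0; have [_ + _] := pointP rho.
move=> /(_ s) /cvg_complexP/(_ _ e0)[_ [[B oB <-] Bs BE]].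
by exists B; [exact: open_nbhs_nbhs|exact: BE].
Qed.

(** How points are produced: it is enough to give the extension. *)
Lemma point_character (f : K -> C) :
  emb 0 = 0 -> {morph emb : s t / s + t} ->
  (forall x, f x != 0) -> {morph f : x y / x + y >-> x * y} -> continuous f ->
  f \o emb <> cst 1 ->
  exists2 rho : points, val rho = f \o emb & is_extension (val rho) f.
Proof.
move=> e0 eD f0 fD cf ne.
have fP : (f \o emb) \in
    [set rho | [/\ is_point rho, local_at K rho & rho <> cst 1]].
  rewrite inE; split=> //.
    by split=> [|s t] /=; rewrite ?e0 ?character0// eD fD.
  move=> s; apply: continuous_comp; last exact: cf.
  exact: initial_continuous.
by exists (Sub (f \o emb) fP).
Qed.

(** Differences are needed for the real place, where the image of the monoid is
    only dense in a half-line. *)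
Hypothesis emb_dense : forall (x : K) B, nbhs x B -> exists s t, B (emb s - emb t).

Lemma extension_unique (rho : Hplus p_pr -> C) (f g : K -> C) :
  is_extension rho f -> is_extension rho g -> f = g.
Proof.
move=> [f0 fD cf fE] [g0 gD cg gE]; apply/funext => x; apply/eqP.
rewrite -subr_eq0 -normc_eq0 eq_le normc_ge0 andbT leNgt; apply/negP => e0.
have {e0} e2 : 0 < normc (f x - g x) / 2 by rewrite divr_gt0.
have nf := (@cvg_complexP R K (nbhs x) (nbhs_filter x) f (f x)).1 (cf x) _ e2.
have ng := (@cvg_complexP R K (nbhs x) (nbhs_filter x) g (g x)).1 (cg x) _ e2.
have [s [t []]] := emb_dense (filterI nf ng).
rewrite /= fD gD !characterN// !fE !gE.
set w := _ * _ => fw gw.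
have := le_normcD (f x - w) (w - g x); rewrite subrKA (normcB w) leNgt.
by rewrite [ltRHS]splitr ltrD.
Qed.

Lemma extensionE (rho : points) f : is_extension (val rho) f -> extension rho = f.
Proof.
move=> ef; rewrite /extension; case: xgetP => [g _ eg|/(_ f)//].
exact: extension_unique eg ef.
Qed.

End Points.

(** Both actions are left translations, read through a bijection of the points
    with the Weil group. *)
Lemma transported_torsor (F : fieldType) (X : Type) (e : X -> multGroup F)
    (h : multGroup F -> X) : cancel e h -> cancel h e ->
  let act w x := h (w * e x)%g in
  [/\ forall x, act 1%g x = x,
      forall u v x, act (u * v)%g x = act u (act v x)
    & principal_homogeneous act].
Proof.
move=> eK hK act; rewrite /act; split=> [x|u v x|].
- by rewrite mul1g eK.
- by rewrite hK mulgA.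
- split; first by exists (h 1%g).
  move=> x y; exists (e y * (e x)^-1)%g; split=> [|u <-].
    by rewrite mulgVK eK.
  by rewrite hK mulgK.
Qed.

(** * Fractions with denominator a power of p, and exponentials of real argument *)

Section Hplus.
Variables (p : nat) (p_pr : prime p).

Lemma Hplus_frac_subproof (k n : nat) : k%:R / p%:R ^+ n \in in_Hplus p_pr.
Proof.
apply/andP; split; first by rewrite divr_ge0 ?exprn_ge0.
by apply/asboolP; exists k%:Z, n.
Qed.

Definition Hplus_frac k n : Hplus p_pr := HPlus (Hplus_frac_subproof k n).

Lemma pnat_neq0 (F : numFieldType) n : p%:R ^+ n != 0 :> F.
Proof. by rewrite expf_neq0 // pnatr_eq0 -lt0n prime_gt0. Qed.

Lemma Hplus_fracP (t : Hplus p_pr) : exists k n, t = Hplus_frac k n.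
Proof.
have /andP[t0 /asboolP[[k|k] [n tE]]] := valP t.
  by exists k, n; apply: val_inj.
have : val t < 0.
  rewrite tE NegzE intrN mulNr oppr_lt0 divr_gt0 ?ltr0z//.
  by rewrite exprn_gt0 // ltr0n prime_gt0.
by rewrite ltNge t0.
Qed.

Lemma Hplus_frac_mulrn k n : Hplus_frac k n = Hplus_frac 1 n *+ k.
Proof.
apply: val_inj; rewrite [RHS](raddfMn (\val : Hplus p_pr -> rat)) /=.
by rewrite -mulrnAl.
Qed.

Lemma Hplus_frac_expand m k n : Hplus_frac k n = Hplus_frac (p ^ m * k) (n + m).
Proof.
apply: val_inj => /=; rewrite natrM natrX exprD mulrC (mulrC (p%:R ^+ m)).
by rewrite -mulf_div divff ?pnat_neq0// mulr1 mulrC.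
Qed.

Lemma expr_unbounded (F : archiRealFieldType) (x : F) : exists n, x < p%:R ^+ n.
Proof.
exists (Num.bound `|x|); rewrite (le_lt_trans (ler_norm x))//.
rewrite (lt_trans (archi_boundP _))// -natrX ltr_nat.
by rewrite ltn_expl ?prime_gt1.
Qed.

Lemma ratr_Hplus_frac (F : numFieldType) k n :
  ratr (val (Hplus_frac k n)) = k%:R / p%:R ^+ n :> F.
Proof. by rewrite /= fmorph_div rmorphXn /= !ratr_nat. Qed.

Section Point.
Variables (R : realType) (rho : Hplus p_pr -> R[i]^o).
Hypothesis rhoP : is_point rho.

Lemma point_mulrn k t : rho (t *+ k) = rho t ^+ k.
Proof.
have [rho0 rhoD] := rhoP; elim: k => [|k ih]; first by rewrite mulr0n rho0.
by rewrite mulrS rhoD ih exprS.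
Qed.

(** A point is determined by its values at the elements 1 / p^n. *)
Lemma point_frac k n : rho (Hplus_frac k n) = rho (Hplus_frac 1 n) ^+ k.
Proof. by rewrite Hplus_frac_mulrn point_mulrn. Qed.

End Point.
End Hplus.

Section Infinity.
Variables (R : realType) (p : nat) (p_pr : prime p).
Local Notation C := R[i]^o.
Local Notation frac := (Hplus_frac p_pr).
Local Notation points := (localPoints R p_pr R^o).
Implicit Types (z w : C) (rho : points).

Definition expchar z (x : R^o) : C := cexp (z * x%:C%C).

Lemma ratr_complex (q : rat) : ratr q = (ratr q : R)%:C%C :> C.
Proof. by rewrite (fmorph_rat (real_complex R)). Qed.

Lemma expchar_emb z (t : Hplus p_pr) :
  expchar z (Hplus_emb R^o t) = cexp (z * ratr (val t)).
Proof. by rewrite /expchar -ratr_complex. Qed.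

Lemma expchar_neq0 z x : expchar z x != 0.
Proof. exact: cexp_neq0. Qed.

Lemma expcharD z : {morph expchar z : x y / x + y >-> x * y}.
Proof. by move=> x y; rewrite /expchar rmorphD mulrDr cexpD. Qed.

Lemma continuous_expchar2 : continuous (fun zx : C * R^o => expchar zx.1 zx.2).
Proof.
move=> [z x]; apply: continuous_comp; last exact: continuous_cexp.
apply: cvgM; first exact: cvg_fst.
apply: cvg_ReIm => /=; last exact: cvg_cst.
exact: cvg_snd.
Qed.

Lemma continuous_expchar z : continuous (expchar z).
Proof.
move=> x; apply: continuous_comp; last exact: continuous_cexp.
apply: cvgM; first exact: cvg_cst.
by apply: cvg_ReIm => /=; [exact: cvg_id|exact: cvg_cst].
Qed.

Lemma real_emb0 : Hplus_emb R^o (0 : Hplus p_pr) = 0.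
Proof. exact: (rmorph0 (@ratr R)). Qed.

Lemma real_embD : {morph Hplus_emb (p_pr := p_pr) R^o : s t / s + t}.
Proof. by move=> s t; exact: (rmorphD (@ratr R)). Qed.

Lemma real_emb_frac k n : Hplus_emb R^o (frac k n) = k%:R / p%:R ^+ n :> R.
Proof. exact: ratr_Hplus_frac. Qed.

Lemma real_emb_dense (x : R^o) B : nbhs x B ->
  exists s t : Hplus p_pr, B (Hplus_emb R^o s - Hplus_emb R^o t).
Proof.
move=> /nbhs_ballP[e /= e0 eB]; have [n en] := expr_unbounded p_pr e^-1.
have pn0 : 0 < p%:R ^+ n :> R by rewrite exprn_gt0 // ltr0n prime_gt0.
set k := Num.floor (x * p%:R ^+ n).
have kB : B (k%:~R / p%:R ^+ n).
  apply: eB; rewrite /ball /= ltr_norml; apply/andP; split.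
    rewrite (lt_le_trans (_ : _ < 0)) ?oppr_lt0// subr_ge0 ler_pdivrMr//.
    by rewrite real_floor_le ?num_real.
  rewrite ltrBlDr -(ltr_pM2r pn0) mulrDl divfK ?gt_eqF// addrC.
  rewrite (lt_le_trans (real_floorD1_gt (num_real _)))// intrD lerD2l.
  by rewrite -ler_pdivrMl ?mulr1 ?ltW.
case: k kB => k kB.
  by exists (frac k n), 0; rewrite real_emb0 subr0 real_emb_frac.
exists 0, (frac k.+1 n); rewrite real_emb0 sub0r real_emb_frac.
by move: kB; rewrite NegzE intrN mulNr.
Qed.

(** For large n the number z / p^n lies in the strip where [clog] inverts
    [cexp], and there only 0 has exponential 1. *)
Lemma expchar_trivial z :
  (forall t : Hplus p_pr, cexp (z * ratr (val t)) = 1) -> z = 0.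
Proof.
move=> z1; have [n nz] := expr_unbounded p_pr (`|complex.Im z| / (pi / 2)).
have pn0 : 0 < p%:R ^+ n :> R by rewrite exprn_gt0 // ltr0n prime_gt0.
have := congr1 (@clog R) (z1 (frac 1 n)).
rewrite clog1 ratr_complex ratr_Hplus_frac mul1r cexpK.
  move/eqP; rewrite mulf_eq0 => /orP[/eqP//|].
  by rewrite fmorph_eq0 invr_eq0 (negPf (pnat_neq0 p_pr R n)).
have -> : complex.Im (z * ((p%:R ^+ n)^-1 : R)%:C%C) = complex.Im z / p%:R ^+ n.
  by case: (z) => a b /=; rewrite mulr0 add0r.
rewrite normrM normfV (ger0_norm (ltW pn0)) ltr_pdivrMr// mulrC -ltr_pdivrMr//.
by rewrite divr_gt0 ?pi_gt0.
Qed.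

Lemma expchar_inj z w : (forall t : Hplus p_pr,
  cexp (z * ratr (val t)) = cexp (w * ratr (val t))) -> z = w.
Proof.
move=> zw; apply/eqP; rewrite -subr_eq0; apply/eqP/expchar_trivial => t.
apply: (mulIf (cexp_neq0 (w * ratr (val t)))).
by rewrite -cexpD -mulrDl subrK zw mul1r.
Qed.
End Infinity.

(** * Points local at infinity are exponentials *)

Section InfinityTorsor.
Variables (R : realType) (p : nat) (p_pr : prime p).
Local Notation C := R[i]^o.
Local Notation frac := (Hplus_frac p_pr).
Local Notation points := (localPoints R p_pr R^o).
Implicit Types (z w : C) (rho : points).

Lemma Im_natmul n z : complex.Im (n%:R * z) = n%:R * complex.Im z.
Proof.
elim: n => [|n ih]; first by rewrite !mul0r.
have ImD w : complex.Im (w + z) = complex.Im w + complex.Im z.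
  by case: w (z) => ? ? [].
by rewrite -!natr1 !mulrDl !mul1r ImD ih.
Qed.

(** On the half-plane where it is defined, the principal logarithm sends z^n to
    n times the logarithm of z only if no intermediate power leaves that
    half-plane. *)
Lemma clog_natmul n z : 0 < complex.Re z ->
  (forall j, (j <= n)%N -> 0 < complex.Re (z ^+ j)) ->
  clog (z ^+ n) = n%:R * clog z.
Proof.
move=> z0 zj; rewrite -{1}(clogK z0) -cexpMn cexpK// Im_natmul.
apply: abs_natmul_lt_pihalf => [|j jn]; first exact: Im_clog.
have := zj j jn; rewrite -{1}(clogK z0) -cexpMn -Im_natmul /=.
by rewrite pmulr_rgt0 ?expR_gt0.
Qed.

(** Near 0 the values of rho lie in the right half-plane. If p^-n is that small,
    [clog_natmul] applies to the p^i-th power of rho(p^-(n+i)), so that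
    the logarithm of rho(p^-(n+i)) is l / p^i, where l is that of rho(p^-n). The
    exponent is then l p^n. *)
Lemma real_point_exp rho :
  exists z, forall t, val rho t = cexp (z * ratr (val t)).
Proof.
have [rhoP _ _] := pointP rho; have [rho0 rhoD] := rhoP.
have [B /nbhs_ballP[e /= e0 eB] Brho] := local_near rho 0 ltr01.
have [n en] := expr_unbounded p_pr e^-1.
have pn0 k : 0 < p%:R ^+ k :> R by rewrite exprn_gt0 // ltr0n prime_gt0.
have Re_gt0 k j : (j <= p ^ k)%N ->
    0 < complex.Re (val rho (frac 1 (n + k)) ^+ j).
  move=> jk; rewrite -point_frac//; apply: Re_gt0_near1.
  have := Brho (frac j (n + k)); rewrite rho0 normcB; apply; apply: eB.
  rewrite real_emb0 /ball /= sub0r normrN real_emb_frac ger0_norm ?divr_ge0 ?exprn_ge0//.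
  rewrite ltr_pdivrMr ?pn0// exprD mulrA; apply: le_lt_trans (_ : p%:R ^+ k < _).
    by rewrite -natrX ler_nat.
  by rewrite ltr_pMl ?pn0// -ltr_pdivrMl// mulr1.
pose l := clog (val rho (frac 1 n)).
have logE i : clog (val rho (frac 1 (n + i))) = l / p%:R ^+ i.
  apply: (mulIf (pnat_neq0 p_pr R[i] i)); rewrite divfK ?pnat_neq0// mulrC.
  rewrite -natrX -clog_natmul; last 2 first.
  - by have := @Re_gt0 i 1%N; rewrite expn_gt0 prime_gt0// => /(_ isT).
  - exact: Re_gt0.
  by rewrite -point_frac// -[(p ^ i)%N]muln1 -Hplus_frac_expand.
exists (l * p%:R ^+ n) => t; have [k [m ->]] := Hplus_fracP t.
rewrite (Hplus_frac_expand p_pr n) addnC point_frac//.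
have /clogK <- : 0 < complex.Re (val rho (frac 1 (n + m))).
  by have := @Re_gt0 m 1%N; rewrite expn_gt0 prime_gt0// => /(_ isT).
rewrite logE -cexpMn; congr cexp; rewrite ratr_Hplus_frac exprD natrM natrX.
by field; rewrite !pnat_neq0.
Qed.

Lemma real_point_exp_unique rho :
  exists! z : multGroup R[i]^o,
    forall t, val rho t = cexp (val z * ratr (val t)).
Proof.
have [z rhoE] := real_point_exp rho; have z0 : z != 0.
  have [_ _] := pointP rho; apply: contra_notN => /eqP z0.
  by apply/funext => t; rewrite rhoE z0 mul0r cexp0.
exists (Sub z z0); split=> // w rhow; apply: val_inj => /=.
by apply: (@expchar_inj R p p_pr) => t; rewrite -rhoE -rhow.
Qed.

Lemma expchar_extension rho z :
  (forall t, val rho t = cexp (z * ratr (val t))) ->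
  is_extension (val rho) (expchar z).
Proof.
move=> rhoE; split=> [x|x y||t].
- exact: expchar_neq0.
- exact: expcharD.
- exact: continuous_expchar.
- by rewrite expchar_emb rhoE.
Qed.

Lemma extension_expchar rho z :
  (forall t, val rho t = cexp (z * ratr (val t))) ->
  extension rho = expchar z.
Proof.
by move=> rhoE; apply: extensionE; [exact: real_emb_dense|exact: expchar_extension].
Qed.

Lemma real_extension_unique rho :
  exists! f : R^o -> C, is_extension (val rho) f.
Proof.
have [z /expchar_extension zE] := real_point_exp rho.
exists (expchar z); split=> // f; apply: extension_unique zE.
exact: real_emb_dense.
Qed.

Lemma expchar_point (z : multGroup R[i]^o) :
  exists rho, forall t, val rho t = cexp (val z * ratr (val t)).
Proof.
have ne : expchar (val z) \o Hplus_emb R^o <> cst 1 :> (Hplus p_pr -> C).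
  move=> /funeqP zE; have := valP z; apply/negP; rewrite negbK; apply/eqP.
  apply: (@expchar_trivial R p p_pr) => t.
  by have := zE t; rewrite /= expchar_emb.
have [rho rhoE _] := point_character (real_emb0 _ p_pr) (@real_embD R p p_pr)
  (expchar_neq0 (val z)) (@expcharD R (val z)) (@continuous_expchar R (val z)) ne.
by exists rho => t; rewrite rhoE /= expchar_emb.
Qed.

(** Joint continuity of exp(z x) becomes uniform in x on a compact set. *)
Lemma expchar_compact z (A : set R^o) (e : R) : compact A -> 0 < e ->
  \forall w \near z, forall x, A x -> normc (expchar z x - expchar w x) < e.
Proof.
move=> /compact_near_coveringP cA e0.
have e2 : 0 < e / 2 by rewrite divr_gt0.
apply: (cA C (nbhs z) (fun w x => normc (expchar z x - expchar w x) < e)) => x Ax.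
have [[U V] /= [Uz Vx] UV] := (@cvg_complexP R _ (nbhs (z, x)) (nbhs_filter _)
   (fun zx => expchar zx.1 zx.2) _).1 (@continuous_expchar2 R (z, x)) _ e2.
exists (V, U) => //= -[y w] /= [Vy Uw].
have wy : normc (expchar z x - expchar w y) < e / 2 := UV (w, y) (conj Uw Vy).
have zy : normc (expchar z x - expchar z y) < e / 2 :=
  UV (z, y) (conj (nbhs_singleton Uz) Vy).
rewrite normcB in zy.
change (normc (expchar z y - expchar w y) < e).
by rewrite -(subrKA (expchar z x)) (le_lt_trans (le_normcD _ _))// [e]splitr ltrD.
Qed.

(** Otherwise the segment from 0 to z crosses a line where the imaginary part is
    pi/2 or -pi/2, and there the exponential is purely imaginary. *)
Lemma Im_lt_pihalf z :
  (forall x : R^o, 0 <= x <= 1 -> 0 < complex.Re (expchar z x)) ->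
  `|complex.Im z| < pi / 2.
Proof.
move=> Re_gt0; rewrite ltNge; apply/negP => Im_ge.
have pi2 : 0 < pi / 2 :> R by rewrite divr_gt0 ?pi_gt0.
have Im_gt0 := lt_le_trans pi2 Im_ge.
have := Re_gt0 (pi / 2 / `|complex.Im z|).
rewrite ler_pdivrMr// mul1r Im_ge divr_ge0 ?(ltW pi2)// => /(_ isT).
have Im0 : complex.Im z != 0 by rewrite -normr_gt0.
rewrite /expchar /= pmulr_rgt0 ?expR_gt0//.
have -> : complex.Im (z * (pi / 2 / `|complex.Im z|)%:C%C) =
    Num.sg (complex.Im z) * (pi / 2).
  have -> : Num.sg (complex.Im z) = complex.Im z / `|complex.Im z|.
    by rewrite {2}[complex.Im z]numEsg mulfK// normr_eq0.
  by case: (z) => a b /=; rewrite mulr0 add0r; ring.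
case: sgrP Im0 => // _ _; rewrite ?mul1r ?mulN1r ?cosN cos_pihalf ltxx//.
Qed.

(** Let z0 and z be the exponents of rho0 and rho, and h = z - z0. If rho is
    uniformly close to rho0 on [0, 1], then exp(h x) is uniformly close to 1
    there. By [Im_lt_pihalf] this confines h to the strip where h is the
    principal logarithm of exp(h), and the logarithm is continuous at 1. *)
Lemma exponent_continuous (f : points -> C) :
  (forall rho t, val rho t = cexp (f rho * ratr (val t))) ->
  continuous f.
Proof.
move=> fE rho0; apply/(cvg_complexP (FF := nbhs_filter rho0)) => e e0.
set z0 := f rho0.
have := @continuous_clog R 1 ltr01 => /cvg_complexP/(_ _ e0).
move=> /nbhs_ballP[[d d']]; rewrite /= ltcE /= => /andP[/eqP-> d0] near1.
have {near1} dlog u : normc (1 - u) < d -> normc (clog u) < e.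
  move=> ud; have : normc (clog 1 - clog u) < e.
    by apply: near1; rewrite -ball_normE /= ltcR.
  by rewrite clog1 sub0r normcN.
have m0 : 0 < Num.min 1 d by rewrite lt_min ltr01.
pose c := expR `|complex.Re z0|; have c0 : 0 < c by exact: expR_gt0.
have cA : compact (`[0, 1]%classic : set R^o) by exact: segment_compact.
apply: filterS (near_points rho0 cA (divr_gt0 m0 c0)) => rho near_rho.
pose h := f rho - z0.
have h1 (x : R^o) : 0 <= x <= 1 -> normc (expchar h x - 1) < Num.min 1 d.
  move=> x01; have := near_rho x; rewrite !(extension_expchar (fE _)) => nx.
  have -> : expchar h x - 1 =
      (expchar (f rho) x - expchar z0 x) * expchar (- z0) x.
    have hE : expchar (f rho) x = expchar h x * expchar z0 x.
      by rewrite /expchar -cexpD -mulrDl subrK.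
    have z0V : expchar z0 x * expchar (- z0) x = 1.
      by rewrite /expchar -cexpD -mulrDl subrr mul0r cexp0.
    by rewrite mulrBl hE -mulrA z0V mulr1.
  rewrite normcM normcB.
  (* c bounds |exp(- z0 x)| on [0, 1] *)
  apply: le_lt_trans (_ : normc (expchar z0 x - expchar (f rho) x) * c < _).
    rewrite ler_wpM2l ?normc_ge0// normc_cexp ler_expR.
    have -> : complex.Re (- z0 * x%:C%C) = - complex.Re z0 * x.
      by case: (z0) => a b /=; rewrite mulr0 subr0.
    case/andP: x01 => x0 x1.
    rewrite (le_trans (ler_norm _))// normrM normrN (ger0_norm x0).
    by rewrite ler_piMr.
  by rewrite -ltr_pdivlMr//; apply: nx; rewrite /= in_itv.
have hlt : `|complex.Im h| < pi / 2.
  apply: Im_lt_pihalf => x x01; apply: Re_gt0_near1.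
  by have := h1 x x01; rewrite lt_min => /andP[].
have := dlog (cexp h); rewrite cexpK// (normcB z0); apply.
have := h1 1; rewrite ler01 lexx (normcB 1) => /(_ isT).
by rewrite /expchar mulr1 lt_min => /andP[].
Qed.

End InfinityTorsor.

(** * The action at infinity *)

Section InfinityAction.
Variables (R : realType) (p : nat) (p_pr : prime p).
Local Notation C := R[i]^o.
Local Notation points := (localPoints R p_pr R^o).
Implicit Types (z w : multGroup R[i]^o) (rho : points).

Lemma real_action : exists act : multGroup R[i]^o -> points -> points,
  [/\ continuous_action act,
      extends_frobenius act,
      (forall w z rho, (forall t, val rho t = cexp (val z * ratr (val t))) ->
         forall t, val (act w rho) t = cexp (val w * val z * ratr (val t)))
    & principal_homogeneous act].
Proof.
have [pt ptE] := choice (@expchar_point R p p_pr).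
have [e eE] : {e : points -> multGroup R[i]^o &
    forall rho t, val rho t = cexp (val (e rho) * ratr (val t))}.
  apply: (@choice _ _ (fun rho z => forall t, val rho t = cexp (val z * ratr (val t)))).
  by move=> rho; have [z [zE _]] := real_point_exp_unique rho; exists z.
have expE rho z : (forall t, val rho t = cexp (val z * ratr (val t))) -> z = e rho.
  move=> zE; apply: val_inj; apply: (@expchar_inj R p p_pr) => t.
  by rewrite -eE zE.
have ptK z : e (pt z) = z by apply/esym/expE; exact: ptE.
have eK rho : pt (e rho) = rho.
  by apply: val_inj; apply/funext => t; rewrite ptE eE.
have [act1 actM torsor] := transported_torsor eK ptK.
exists (fun w rho => pt (w * e rho)%g); split.
- split=> // -[w0 rho0]; apply: cvg_points => A d cA d0.
  have c1 : (val ux.1 : C) @[ux --> (w0, rho0)] --> (val w0 : C).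
    exact: (cvg_comp fst val cvg_fst (@initial_continuous _ C val w0)).
  have c2 : (val (e ux.2) : C) @[ux --> (w0, rho0)] --> (val (e rho0) : C).
    apply: (cvg_comp snd (val \o e) cvg_snd).
    by apply: (@exponent_continuous R p p_pr); exact: eE.
  have cont : (val (ux.1 * e ux.2)%g : C) @[ux --> (w0, rho0)]
      --> (val (w0 * e rho0)%g : C) by exact: (cvgM c1 c2).
  have := expchar_compact (val (w0 * e rho0)%g) cA d0.
  move=> /cont near_exp.
  apply: (@filterS _ _ (nbhs_filter (w0, rho0)) _ _ _ near_exp) => -[w rho] h x Ax.
  by rewrite !(extension_expchar (ptE _)); exact: h.
- move=> n n0; have nC : n%:R != 0 :> C by rewrite pnatr_eq0 -lt0n.
  exists (Sub n%:R nC) => // rho; apply/funext => t.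
  by rewrite /frobenius ptE (eE rho) -cexpMn; congr cexp; exact/esym/mulrA.
- by move=> w z rho /expE -> t; rewrite ptE.
- exact: torsor.
Qed.

End InfinityAction.

(** * The norm and the dense subsets of Q_p *)

Section PadicField.
Variables (p : nat) (p_pr : prime p).
Local Notation Qp := (Qp p_pr).
Local Notation N := (padic_norm p).
Implicit Types x y : Qp.

Lemma padic_const_cauchy (q : rat) : (fun=> q) \in padic_cauchy p_pr.
Proof.
by apply/padic_cauchyP => e e0; exists 0%N => m n _ _; rewrite subrr padic_norm0.
Qed.

Definition padic_const (q : rat) : padic_seq p_pr := PadicSeq (padic_const_cauchy q).

(** Equal to [ratr] by [ratr_Qp]; in this form the morphism properties and the
    norm can be read off from a constant sequence. *)
Definition Qp_rat (q : rat) : Qp := Qp_of (padic_const q).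

Lemma Qp_rat_zmod_morphism : zmod_morphism Qp_rat.
Proof.
by move=> q r; rewrite /Qp_rat -rmorphB; congr Qp_of; apply: val_inj.
Qed.

Lemma Qp_rat_monoid_morphism : monoid_morphism Qp_rat.
Proof.
split.
  by rewrite /Qp_rat -[RHS](rmorph1 (@Qp_of p p_pr)); congr Qp_of; apply: val_inj.
by move=> q r; rewrite /Qp_rat -rmorphM; congr Qp_of; apply: val_inj.
Qed.

HB.instance Definition _ :=
  GRing.isZmodMorphism.Build rat Qp Qp_rat Qp_rat_zmod_morphism.
HB.instance Definition _ :=
  GRing.isMonoidMorphism.Build rat Qp Qp_rat Qp_rat_monoid_morphism.

Lemma ratr_Qp (q : rat) : ratr q = Qp_rat q.
Proof.
by rewrite -[in RHS](divq_num_den q) fmorph_div !rmorph_int.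
Qed.

Lemma Qp_natr n : n%:R = Qp_rat n%:R :> Qp.
Proof. by rewrite rmorph_nat. Qed.

Lemma Qp_norm_rat (q : rat) : Qp_norm (Qp_rat q) = N q.
Proof. by apply: Qp_normP => e e0; exists 0%N => n _; rewrite subrr normr0. Qed.

Lemma Qp_norm_stable (u : padic_seq p_pr) : Qp_of u != 0 ->
  exists n0, forall n, (n0 <= n)%N -> N (u n) = Qp_norm (Qp_of u).
Proof.
rewrite Qp_of_eq0 => /padic_norm_stable[c [n0 [c0 uc]]]; exists n0 => n n0n.
rewrite uc//; apply/esym/Qp_normP => e e0; exists n0 => m n0m.
by rewrite uc// subrr normr0.
Qed.

Lemma Qp_norm_le (u : padic_seq p_pr) c n0 :
  (forall n, (n0 <= n)%N -> N (u n) <= c) -> Qp_norm (Qp_of u) <= c.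
Proof.
move=> uc; have [->|/Qp_norm_stable[n1 uE]] := eqVneq (Qp_of u) 0.
  by rewrite Qp_norm0 (le_trans _ (uc n0 _))// padic_norm_ge0.
by rewrite -(uE (maxn n0 n1)) ?leq_maxr// uc ?leq_maxl.
Qed.

Lemma Qp_norm_ge0 x : 0 <= Qp_norm x.
Proof.
have [->|] := eqVneq x 0; first by rewrite Qp_norm0.
rewrite -[x]Qp_reprK => /Qp_norm_stable[n uE].
by rewrite -(uE n (leqnn n)) padic_norm_ge0.
Qed.

Lemma Qp_normM x y : Qp_norm (x * y) = Qp_norm x * Qp_norm y.
Proof.
have [->|x0] := eqVneq x 0; first by rewrite mul0r Qp_norm0 mul0r.
have [->|y0] := eqVneq y 0; first by rewrite mulr0 Qp_norm0 mulr0.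
move: x0 y0; rewrite -[x]Qp_reprK -[y]Qp_reprK.
move=> /Qp_norm_stable[n1 uE] /Qp_norm_stable[n2 vE].
rewrite -rmorphM; apply: Qp_normP => e e0; exists (maxn n1 n2) => n.
rewrite geq_max => /andP[/uE {}uE /vE {}vE].
change (`|N (Qp_repr x n * Qp_repr y n) - Qp_norm (Qp_of (Qp_repr x)) *
  Qp_norm (Qp_of (Qp_repr y))| < e).
by rewrite padic_normM// uE vE subrr normr0.
Qed.

Lemma Qp_norm_le_max x y c : Qp_norm x <= c -> Qp_norm y <= c ->
  Qp_norm (x + y) <= c.
Proof.
have bound (z : Qp) : Qp_norm z <= c ->
    forall e, 0 < e -> exists n0, forall n, (n0 <= n)%N -> N (Qp_repr z n) <= c + e.
  move=> zc e e0; have [n0 zE] := @Qp_normE p p_pr (Qp_repr z) e e0.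
  exists n0 => n /zE.
  rewrite Qp_reprK ltr_norml => /andP[_]; rewrite ltrBlDl => /ltW h.
  by rewrite (le_trans h)// lerD2r.
move=> /bound xb /bound yb; apply/ler_addgt0Pr => e e0.
have [n1 h1] := xb _ e0; have [n2 h2] := yb _ e0.
rewrite -[x]Qp_reprK -[y]Qp_reprK -rmorphD; apply: (@Qp_norm_le _ _ (maxn n1 n2)).
move=> n; rewrite geq_max => /andP[/h1 {}h1 /h2 {}h2].
change (N (Qp_repr x n + Qp_repr y n) <= c + e).
by rewrite (le_trans (padic_normD _ _ _))// ge_max h1 h2.
Qed.

Lemma Qp_normB x y : Qp_norm (x - y) = Qp_norm (y - x).
Proof. by rewrite -Qp_normN opprB. Qed.

Lemma Qp_norm_p n : Qp_norm (p%:R ^+ n : Qp) = p%:R ^- n.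
Proof.
have P0 : (p ^ n)%:Z != 0 by rewrite eqz_nat expn_eq0 negb_and -lt0n prime_gt0.
rewrite Qp_natr -rmorphXn Qp_norm_rat -natrX -[X in N X]divr1.
rewrite (@padic_normE _ p_pr (p ^ n)%:Z 1)// logn1 expr0 mul1r absz_nat.
by rewrite pfactorK// natrX.
Qed.

Lemma padic_norm_int_le n (a : int) :
  (N a%:~R <= p%:R ^- n) = ((p ^ n)%:Z %| a)%Z.
Proof.
have [->|a0] := eqVneq a 0.
  by rewrite padic_norm0 dvdz0 invr_ge0 exprn_ge0.
rewrite -[a%:~R]divr1 (@padic_normE _ p_pr a 1)// logn1 expr0 mul1r.
have p1 : 1 < p%:R :> rat by rewrite ltr1n prime_gt1.
rewrite lef_pV2 ?posrE ?exprn_gt0 ?(lt_trans ltr01)// ler_eXn2l//.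
by rewrite dvdzE absz_nat pfactor_dvdn// absz_gt0.
Qed.

Lemma Qp_norm_nat_le n k : (Qp_norm (k%:R : Qp) <= p%:R ^- n) = (p ^ n %| k)%N.
Proof. by rewrite Qp_natr Qp_norm_rat -[k%:R]/(k%:Z%:~R) padic_norm_int_le. Qed.

Lemma Qp_norm_nat_le1 k : Qp_norm (k%:R : Qp) <= 1.
Proof. by have := Qp_norm_nat_le 0 k; rewrite expr0 invr1 dvd1n. Qed.

Lemma near_QpP x (B : set Qp) : nbhs x B <->
  exists n, forall y, Qp_norm (x - y) <= p%:R ^- n -> B y.
Proof.
have p0 n : 0 < p%:R ^+ n :> rat by rewrite exprn_gt0 // ltr0n prime_gt0.
split=> [/nbhs_ballP[e /= e0 eB]|[n nB]].
  have [n en] := expr_unbounded p_pr e^-1; exists n => y xy; apply: eB.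
  rewrite ballEmdist /=; apply: le_lt_trans xy _.
  by rewrite invf_plt ?posrE.
apply/nbhs_ballP; exists (p%:R ^- n) => /=; first by rewrite invr_gt0.
by move=> y; rewrite ballEmdist => /= /ltW; exact: nB.
Qed.

(** Write the denominator of q as b p^m with b prime to p. Replacing 1 / b by an
    inverse of b modulo p^(n+m) and the numerator by a non-negative residue
    changes q by at most p^-n. *)
Lemma rat_Hplus_approx (q : rat) n :
  exists t : Hplus p_pr, N (q - val t) <= p%:R ^- n.
Proof.
have d0 : `|denq q|%N != 0%N by rewrite absz_eq0 denq_eq0.
set m := logn p `|denq q|.
have [//|b cpb dE] := pfactor_coprime p_pr (_ : 0 < `|denq q|)%N.
  by rewrite lt0n.
have {}dE : denq q = b%:Z * (p ^ m)%:Z by rewrite -[denq q]gez0_abs// dE.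
have /coprimezP[[u v] /= uv1] : coprimez b%:Z (p ^ (n + m))%:Z.
  by rewrite coprimezE !absz_nat coprimeXr// coprime_sym.
set P : int := (p ^ (n + m))%:Z in uv1 *.
have P0 : P != 0 by rewrite eqz_nat expn_eq0 negb_and -lt0n prime_gt0.
pose k := `|((numq q * u) %% P)%Z|%N.
have kE : k%:Z = ((numq q * u) %% P)%Z by rewrite gez0_abs// modz_ge0.
have Pdvd : (P %| numq q - k%:Z * b%:Z)%Z.
  have -> : numq q - k%:Z * b%:Z =
      (numq q * u - k%:Z) * b%:Z + numq q * v * P.
    by rewrite -[in LHS](mulr1 (numq q)) -uv1; ring.
  apply: rpredD; last exact: dvdz_mull.
  by apply: dvdz_mulr; rewrite kE -eqz_mod_dvd modz_mod.
exists (Hplus_frac p_pr k m) => /=.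
have p0 i : 0 < p%:R ^+ i :> rat by rewrite exprn_gt0 // ltr0n prime_gt0.
have dN : N (denq q)%:~R = p%:R ^- m.
  by rewrite -[X in N X]divr1 (@padic_normE _ p_pr _ 1)// logn1 expr0 mul1r.
have qE : (q - k%:R / p%:R ^+ m) * (denq q)%:~R = (numq q - k%:Z * b%:Z)%:~R.
  have pmE : (p ^ m)%:Z%:~R = p%:R ^+ m :> rat by rewrite -natrX.
  rewrite mulrBl -{1}[q]divq_num_den divfK ?intr_eq0 ?denq_eq0//.
  rewrite intrB intrM dE intrM pmE.
  by field; rewrite gt_eqF.
rewrite -(@ler_pM2r _ (p%:R ^- m)) ?invr_gt0//.
rewrite -[X in _ * X <= _]dN -padic_normM// qE.
by rewrite -invfM -exprD padic_norm_int_le.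
Qed.

Lemma Hplus_approx x n :
  exists t : Hplus p_pr, Qp_norm (x - Hplus_emb Qp t) <= p%:R ^- n.
Proof.
have p0 : 0 < p%:R ^- n :> rat by rewrite invr_gt0 exprn_gt0 // ltr0n prime_gt0.
have /padic_cauchyP/(_ _ p0)[n0 uc] := valP (Qp_repr x).
have [t qt] := rat_Hplus_approx (Qp_repr x n0) n; exists t.
rewrite /Hplus_emb ratr_Qp -(subrKA (Qp_rat (Qp_repr x n0))).
apply: Qp_norm_le_max; last by rewrite -rmorphB Qp_norm_rat.
rewrite -[x in x - _]Qp_reprK /Qp_rat -rmorphB.
by apply: (@Qp_norm_le _ _ n0) => m n0m; apply/ltW; exact: uc.
Qed.

Lemma Qp_emb0 : Hplus_emb Qp (0 : Hplus p_pr) = 0.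
Proof. by rewrite /Hplus_emb ratr_Qp; exact: (rmorph0 Qp_rat). Qed.

Lemma Qp_embD : {morph Hplus_emb (p_pr := p_pr) Qp : s t / s + t}.
Proof. by move=> s t; rewrite /Hplus_emb !ratr_Qp; exact: (rmorphD Qp_rat). Qed.

Lemma Qp_emb_frac k n : Hplus_emb Qp (Hplus_frac p_pr k n) = k%:R / p%:R ^+ n.
Proof.
by rewrite /Hplus_emb ratr_Qp fmorph_div rmorphXn !rmorph_nat.
Qed.

(** The natural numbers are dense in Z_p: an element of the monoid whose p-adic
    norm is at most 1 is a natural number. *)
Lemma nat_approx x n : Qp_norm x <= 1 ->
  exists k : nat, Qp_norm (x - k%:R) <= p%:R ^- n.
Proof.
move=> x1; have [t xt] := Hplus_approx x n.
have [k [m tE]] := Hplus_fracP t; rewrite tE Qp_emb_frac in xt.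
have pm0 : p%:R ^+ m != 0 :> Qp.
  by rewrite -natrX Qp_natr fmorph_eq0 natrX pnat_neq0.
have t1 : Qp_norm (k%:R / p%:R ^+ m : Qp) <= 1.
  rewrite -[X in Qp_norm X](subKr x); apply: Qp_norm_le_max => //.
  rewrite Qp_normN (le_trans xt)// invf_le1 ?exprn_gt0 ?ltr0n ?prime_gt0//.
  by rewrite exprn_ege1// ler1n prime_gt0.
have /dvdnP[j kE] : (p ^ m %| k)%N.
  rewrite -Qp_norm_nat_le -[k%:R](divfK pm0) Qp_normM Qp_norm_p.
  by rewrite ler_piMl// invr_ge0 exprn_ge0.
by exists j; move: xt; rewrite kE natrM natrX mulfK.
Qed.

Lemma Qp_emb_dense x (B : set Qp) : nbhs x B ->
  exists s t : Hplus p_pr, B (Hplus_emb Qp s - Hplus_emb Qp t).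
Proof.
move=> /near_QpP[n nB]; have [t xt] := Hplus_approx x n.
by exists t, 0; rewrite Qp_emb0 subr0; exact: nB.
Qed.

End PadicField.

(** * Extension of p-adically local points *)

Section QpCharacters.
Variables (R : realType) (p : nat) (p_pr : prime p).
Local Notation C := R[i]^o.
Local Notation Qp := (Qp p_pr).
Local Notation frac := (Hplus_frac p_pr).
Local Notation emb := (Hplus_emb (p_pr := p_pr) Qp).
Local Notation points := (localPoints R p_pr Qp).
Implicit Types (x y : Qp) (f : Qp -> C) (s t : Hplus p_pr).

Lemma Hplus_subr s t : val s <= val t -> exists u, t = s + u.
Proof.
have [[k [m ->]] [l [n ->]]] := (Hplus_fracP s, Hplus_fracP t).
rewrite (Hplus_frac_expand p_pr n k) (Hplus_frac_expand p_pr m l) (addnC n).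
move: (p ^ n * k)%N (p ^ m * l)%N (m + n)%N => {k l m n} k l n /=.
rewrite ler_pM2r ?invr_gt0 ?exprn_gt0 ?ltr0n ?prime_gt0// ler_nat => kl.
exists (frac (l - k) n).
rewrite (Hplus_frac_mulrn _ k) (Hplus_frac_mulrn _ (l - k)).
by rewrite -mulrnDr subnKC// -Hplus_frac_mulrn.
Qed.

(** The monoid has no subtraction, but the larger of two of its elements is the
    smaller one plus a third. *)
Lemma point_locally_constant (rho : Hplus p_pr -> C) n : is_point rho ->
  (forall t, Qp_norm (emb t) <= p%:R ^- n -> rho t = 1) ->
  forall s t, Qp_norm (emb s - emb t) <= p%:R ^- n -> rho s = rho t.
Proof.
move=> [rho0 rhoD] triv s t.
wlog st : s t / val s <= val t => [wl|].
  have [|/ltW] := leP (val s) (val t); first exact: wl.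
  by move=> ts; rewrite Qp_normB => /(wl _ _ ts).
have [u ->] := Hplus_subr st.
rewrite Qp_normB Qp_embD addrC addKr => /triv u1.
by rewrite rhoD u1 mulr1.
Qed.

(** The value at x is that of rho at any element of the monoid within p^-n of x,
    since rho does not distinguish two such elements. *)
Lemma locally_trivial_extension (rho : Hplus p_pr -> C) n : is_point rho ->
  (forall t, Qp_norm (emb t) <= p%:R ^- n -> rho t = 1) ->
  exists2 f, is_extension rho f & forall x, Qp_norm x <= p%:R ^- n -> f x = 1.
Proof.
move=> rhoP triv; have [rho0 rhoD] := rhoP.
have [a aP] := choice (fun x => Hplus_approx x n).
have aE x s : Qp_norm (x - emb s) <= p%:R ^- n -> rho (a x) = rho s.
  move=> xs; apply: (point_locally_constant rhoP triv).
  rewrite -(subrKA x) Qp_norm_le_max// Qp_normB; exact: aP.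
have fD x y : rho (a (x + y)) = rho (a x) * rho (a y).
  rewrite -rhoD; apply: aE.
  by rewrite Qp_embD opprD addrACA; apply: Qp_norm_le_max; exact: aP.
have f1 x : Qp_norm x <= p%:R ^- n -> rho (a x) = 1.
  by rewrite -rho0 => xn; apply: aE; rewrite Qp_emb0 subr0.
exists (rho \o a) => //; split=> //=.
- move=> x; have : rho (a x) * rho (a (- x)) = 1.
    by rewrite -fD subrr f1// Qp_norm0 invr_ge0 exprn_ge0.
  by apply: contra_eq_neq => ->; rewrite mul0r eq_sym oner_eq0.
- move=> x; apply/(cvg_complexP (FF := nbhs_filter x)) => e e0.
  apply/near_QpP; exists n => y xy /=; suff -> : rho (a y) = rho (a x).
    by rewrite subrr normc0.
  by rewrite -[y](subrK x) fD f1 ?mul1r// Qp_normB.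
- by move=> t; apply: aE; rewrite subrr Qp_norm0 invr_ge0 exprn_ge0.
Qed.

(** All the multiples of a p-adically small element are as small, so the powers
    of its image stay close to 1. *)
Lemma point_locally_trivial (rho : points) :
  exists n, forall t, Qp_norm (emb t) <= p%:R ^- n -> val rho t = 1.
Proof.
have [rhoP _ _] := pointP rho; have [rho0 rhoD] := rhoP.
have half0 : 0 < 2^-1 :> R by rewrite invr_gt0.
have [B /near_QpP[n nB] Brho] := local_near rho 0 half0.
exists n => t tn; apply: no_small_subgroup => k.
have := Brho (t *+ k); rewrite rho0 normcB point_mulrn// => h.
apply/ltW/h/nB; rewrite Qp_emb0 sub0r Qp_normN.
have -> : emb (t *+ k) = k%:R * emb t.
  elim: k {h} => [|k ih]; first by rewrite mulr0n mul0r Qp_emb0.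
  by rewrite mulrS Qp_embD ih -natr1 mulrDl mul1r addrC.
rewrite Qp_normM (le_trans _ tn)// ler_piMl ?Qp_norm_ge0//.
exact: Qp_norm_nat_le1.
Qed.

Lemma padic_extension_ex (rho : points) : exists f : Qp -> C, is_extension (val rho) f.
Proof.
have [n triv] := point_locally_trivial rho; have [rhoP _ _] := pointP rho.
by have [f fE _] := locally_trivial_extension rhoP triv; exists f.
Qed.

Lemma padic_extensionP (rho : points) : is_extension (val rho) (extension rho).
Proof.
have [f fE] := padic_extension_ex rho.
by rewrite (extensionE (@Qp_emb_dense p p_pr) fE).
Qed.

End QpCharacters.

(** * Continuous characters of Q_p *)

Section QpDual.
Variables (R : realType) (p : nat) (p_pr : prime p).
Local Notation C := R[i]^o.
Local Notation Qp := (Qp p_pr).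
Local Notation frac := (Hplus_frac p_pr).
Local Notation emb := (Hplus_emb (p_pr := p_pr) Qp).
Local Notation points := (localPoints R p_pr Qp).
Implicit Types (x y : Qp) (f : Qp -> C) (s t : Hplus p_pr).

Lemma Qp_p_neq0 n : p%:R ^+ n != 0 :> Qp.
Proof. by rewrite -natrX Qp_natr fmorph_eq0 natrX pnat_neq0. Qed.

Lemma Qp_norm_pV n : Qp_norm (p%:R ^- n : Qp) = p%:R ^+ n.
Proof.
apply: divr1_eq; rewrite -Qp_norm_p -Qp_normM mulVf ?Qp_p_neq0//.
by have := Qp_norm_p p_pr 0; rewrite !expr0 invr1.
Qed.

Definition is_character f :=
  [/\ forall x, f x != 0, {morph f : x y / x + y >-> x * y} & continuous f].

Lemma extension_character (rho : points) : is_character (extension rho).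
Proof. by have [] := padic_extensionP rho. Qed.

Lemma Qp_mul_continuous y : continuous (fun x : Qp => y * x).
Proof.
move=> x B /near_QpP[n nB]; have [y0|y0] := eqVneq y 0.
  by apply/near_QpP; exists 0%N => z _ /=; apply: nB;
    rewrite y0 !mul0r subrr Qp_norm0 invr_ge0 exprn_ge0.
have [m ym] := expr_unbounded p_pr (Qp_norm y).
apply/near_QpP; exists (n + m)%N => z xz /=; apply: nB.
rewrite -mulrBr Qp_normM.
apply: le_trans (ler_pM (Qp_norm_ge0 _) (Qp_norm_ge0 _) (ltW ym) xz) _.
by rewrite exprD invfM mulrCA divff ?pnat_neq0// mulr1.
Qed.

Lemma character_scale f y : is_character f -> is_character (fun x => f (y * x)).
Proof.
move=> [f0 fD cf]; split=> [x|x z|]; first exact: f0.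
  by rewrite mulrDr fD.
by move=> x; apply: continuous_comp; [exact: Qp_mul_continuous|exact: cf].
Qed.

Lemma character_locally_trivial f : is_character f ->
  exists n, forall x, Qp_norm x <= p%:R ^- n -> f x = 1.
Proof.
move=> [f0 fD cf]; have half0 : 0 < 2^-1 :> R by rewrite invr_gt0.
have := (@cvg_complexP R Qp (nbhs 0) (nbhs_filter _) f (f 0)).1 (cf 0) _ half0.
move=> /near_QpP[n nB]; exists n => x xn; apply: no_small_subgroup => k.
rewrite -character_natmul// -(character0 f0 fD) normcB; apply/ltW/nB.
rewrite sub0r Qp_normN Qp_normM (le_trans _ xn)// ler_piMl ?Qp_norm_ge0//.
exact: Qp_norm_nat_le1.
Qed.

(** The multiples of p^n by natural numbers are dense in the ball, and f is
    locally constant. *)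
Lemma character_trivial_ball f n : is_character f -> f (p%:R ^+ n) = 1 ->
  forall x, Qp_norm x <= p%:R ^- n -> f x = 1.
Proof.
move=> fC fn x xn; have [f0 fD _] := fC.
have [m fm] := character_locally_trivial fC.
have [|k xk] := @nat_approx p p_pr (x / p%:R ^+ n) m.
  rewrite Qp_normM Qp_norm_pV -ler_pdivlMr ?exprn_gt0 ?ltr0n ?prime_gt0//.
  by rewrite mul1r.
rewrite -[x](divfK (Qp_p_neq0 n)) -[x / _](subrK k%:R) mulrDl fD.
rewrite character_natmul// fn expr1n mulr1 fm// Qp_normM Qp_norm_p.
rewrite (le_trans _ xk)// ler_piMr ?Qp_norm_ge0//.
rewrite invf_le1 ?exprn_gt0 ?ltr0n ?prime_gt0//.
by rewrite exprn_ege1// ler1n prime_gt0.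
Qed.

(** There are only p powers of z, all within p |z - 1| of 1, so
    [no_small_subgroup] applies. *)
Lemma root_of_unity_near1 (z : C) :
  z ^+ p = 1 -> normc (z - 1) < (2 * p%:R)^-1 -> z = 1.
Proof.
move=> zp z1; have p0 : 0 < p%:R :> R by rewrite ltr0n prime_gt0.
have nz : normc z = 1.
  apply/eqP; rewrite -(@pexpr_eq1 _ _ p) ?prime_gt0 ?normc_ge0//.
  by rewrite -normcX zp normc1.
have powers j : normc (z ^+ j - 1) <= j%:R * normc (z - 1).
  elim: j => [|j ih]; first by rewrite subrr normc0 mul0r.
  have -> : z ^+ j.+1 - 1 = z ^+ j * (z - 1) + (z ^+ j - 1).
    by rewrite mulrBr mulr1 addrA subrK -exprSr.
  rewrite (le_trans (le_normcD _ _))// normcM normcX nz expr1n mul1r.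
  by rewrite -natr1 mulrDl mul1r addrC lerD2r.
apply: no_small_subgroup => n; rewrite -(expr_mod n zp).
rewrite (le_trans (powers _))//.
apply: le_trans (_ : p%:R * (2 * p%:R)^-1 <= _); last first.
  by rewrite invfM mulrCA divff ?gt_eqF// mulr1.
by rewrite ler_pM ?normc_ge0 ?(ltW z1)// ler_nat ltnW// ltn_mod prime_gt0.
Qed.

(** The value at p^k is 1 for large k, and each value is the p-th power of the
    previous one: descending on k, [root_of_unity_near1] keeps it equal to 1. *)
Lemma character_near1 f n : is_character f ->
  (forall k, (n <= k)%N -> normc (f (p%:R ^+ k) - 1) < (2 * p%:R)^-1) ->
  f (p%:R ^+ n) = 1.
Proof.
move=> fC near1; have [f0 fD _] := fC.
have [m fm] := character_locally_trivial fC.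
suff desc j : f (p%:R ^+ (n + (m - j))) = 1 by rewrite -(desc m) subnn addn0.
elim: j => [|j ih].
  rewrite subn0 fm// exprD Qp_normM !Qp_norm_p ler_piMl ?invr_ge0 ?exprn_ge0//.
  rewrite invf_le1 ?exprn_gt0 ?ltr0n ?prime_gt0//.
  by rewrite exprn_ege1// ler1n prime_gt0.
have [mj|jm] := leqP m j.
  have mj0 : (m - j = 0)%N by apply/eqP; rewrite subn_eq0.
  have mj1 : (m - j.+1 = 0)%N by apply/eqP; rewrite subn_eq0 leqW.
  by rewrite mj1 -mj0.
apply: root_of_unity_near1; last by rewrite near1// leq_addr.
by rewrite -character_natmul// -exprS -addnS -subSn// subSS.
Qed.

Lemma compact_powers n :
  compact [set x : Qp | x = 0 \/ exists2 k, (n <= k)%N & x = p%:R ^+ k].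
Proof.
apply/compact_near_coveringP => I F P FF cover.
have [[U V] /= [/near_QpP[m mU] FV] UV] := cover 0 (or_introl erefl).
have fin : \near F, forall k : 'I_m, (n <= k)%N -> P F (p%:R ^+ k).
  apply: filter_forall => k; have [nk|kn] := leqP n k; last first.
    by apply: nearW => i.
  have [[U' V'] /= [U'k FV'] UV'] :=
    cover _ (or_intror (ex_intro2 _ _ (k : nat) nk erefl)).
  by apply: filterS FV' => i V'i _; exact: (UV' (_, i) (conj (nbhs_singleton U'k) V'i)).
near=> i => x [->|[k nk ->]].
  have Vi : V i by near: i.
  apply: (UV (0, i)); split=> //; apply: mU.
  by rewrite subrr Qp_norm0 invr_ge0 exprn_ge0.
have [km|mk] := ltnP k m.
  by have fini := near fin i; exact: (fini _ (Ordinal km)).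
have Vi : V i by near: i.
apply: (UV (_, i)); split=> //; apply: mU.
rewrite sub0r Qp_normN Qp_norm_p lef_pV2 ?posrE ?exprn_gt0 ?ltr0n ?prime_gt0//.
by rewrite ler_weXn2l// ler1n prime_gt0.
Unshelve. all: by end_near. Qed.

End QpDual.

(** * Self-duality of Q_p *)

Section StandardCharacter.
Variables (R : realType) (p : nat) (p_pr : prime p).
Local Notation C := R[i]^o.
Local Notation Qp := (Qp p_pr).
Local Notation frac := (Hplus_frac p_pr).
Local Notation emb := (Hplus_emb (p_pr := p_pr) Qp).
Implicit Types (x y : Qp) (f : Qp -> C) (s t : Hplus p_pr).

Definition two_pi_i : C := (0 +i* (pi *+ 2))%C.

Lemma cexp_two_pi_i : cexp two_pi_i = 1.
Proof. by rewrite /cexp /= expR0 cos2pi sin2pi mulr1 mulr0. Qed.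

Lemma cexp_two_pi_i_eq1 (r : R) : 0 <= r < 1 ->
  cexp (two_pi_i * r%:C%C) = 1 -> r = 0.
Proof.
case/andP; rewrite le_eqVlt => /predU1P[<-//|r0] r1 /(congr1 (@complex.Re R)).
have -> : two_pi_i * r%:C%C = (0 +i* ((pi * r) *+ 2))%C :> C.
  by apply/eqP; rewrite eq_complex /=; apply/andP; split; apply/eqP; ring.
rewrite /= expR0 mul1r cos_mulr2n => cos1.
have sin0 : 0 < sin (pi * r).
  by rewrite sin_gt0_pi// mulr_gt0 ?pi_gt0//= gtr_pMr ?pi_gt0.
have := cos2Dsin2 (pi * r); have := exprn_gt0 2 sin0.
by move: cos1; set a := _ ^+ 2; set b := _ ^+ 2; lra.
Qed.

Definition torsion_point t : C := cexp (two_pi_i * ratr (val t)).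

Lemma torsion_pointP : is_point torsion_point.
Proof.
split=> [|s t]; rewrite /torsion_point.
  by rewrite [ratr _](rmorph0 (@ratr C)) mulr0 cexp0.
by rewrite [ratr _](rmorphD (@ratr C)) mulrDr cexpD.
Qed.

Lemma torsion_point_nat k : torsion_point (frac k 0) = 1.
Proof.
rewrite /torsion_point ratr_Hplus_frac expr0 divr1 mulrC cexpMn cexp_two_pi_i.
by rewrite expr1n.
Qed.

(** An element of the monoid of p-adic norm at most 1 is an integer. *)
Lemma torsion_point_trivial t : Qp_norm (emb t) <= p%:R ^- 0 -> torsion_point t = 1.
Proof.
have [k [m ->]] := Hplus_fracP t; rewrite Qp_emb_frac Qp_normM Qp_norm_pV.
rewrite -ler_pdivlMr ?exprn_gt0 ?ltr0n ?prime_gt0// expr0 invr1 mul1r.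
rewrite Qp_norm_nat_le => /dvdnP[j ->].
by rewrite mulnC -[X in frac _ X]add0n -Hplus_frac_expand torsion_point_nat.
Qed.

(** exp(2 i pi r) = 1 is impossible for 0 < r < 1, here with r = j / p^k. *)
Lemma torsion_point_prim k :
  (p ^ k).-primitive_root (torsion_point (frac 1 k) : R[i]).
Proof.
apply/andP; split; first by rewrite expn_gt0 prime_gt0.
apply/forallP => -[j /= jk]; rewrite unity_rootE.
rewrite -(point_frac torsion_pointP) eqn_leq jk /=.
apply/eqP; apply/eqP/idP => [|kj].
  rewrite leqNgt => z1; apply/negP => {}jk; move: z1.
  rewrite /torsion_point ratr_complex ratr_Hplus_frac => /cexp_two_pi_i_eq1.
  have P0 : 0 < p%:R ^+ k :> R by rewrite exprn_gt0 // ltr0n prime_gt0.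
  rewrite divr_ge0 ?(ltW P0)// ltr_pdivrMr// mul1r -natrX ltr_nat => /(_ jk)/eqP.
  by rewrite mulf_eq0 invr_eq0 natrX (negPf (pnat_neq0 p_pr R k)) pnatr_eq0.
have -> : j.+1 = (p ^ k * 1)%N by rewrite muln1; apply/eqP; rewrite eqn_leq jk.
by rewrite -[X in frac _ X]add0n -Hplus_frac_expand torsion_point_nat.
Qed.

Lemma standard_character : exists psi : Qp -> C,
  [/\ is_character psi, forall x, Qp_norm x <= 1 -> psi x = 1
    & forall k, (p ^ k).-primitive_root (psi (p%:R ^- k) : R[i])].
Proof.
have [psi [psi0 psiD cpsi psiE] triv] :=
  locally_trivial_extension torsion_pointP torsion_point_trivial.
exists psi; split=> // k.
by have := torsion_point_prim k; rewrite -psiE Qp_emb_frac mul1r.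
Qed.

(** Since a m = a k modulo p^k for all m >= k, the sequence a is p-adically
    Cauchy, and the congruences pass to its limit. *)
Lemma digit_limit (a : nat -> nat) :
  (forall k, (a k.+1 = a k %[mod p ^ k])%N) ->
  exists w : Qp, forall k, Qp_norm (w - (a k)%:R) <= p%:R ^- k.
Proof.
move=> aS; have aE k m : (k <= m)%N -> (a m = a k %[mod p ^ k])%N.
  move=> /subnK <-; elim: (m - k)%N => [//|j ih]; rewrite addSn -ih.
  have dv : (p ^ k %| p ^ (j + k))%N by rewrite dvdn_exp2l ?leq_addl.
  by rewrite -(modn_dvdm _ dv) aS modn_dvdm.
have aN k m : (k <= m)%N -> padic_norm p ((a m)%:R - (a k)%:R) <= p%:R ^- k.
  move=> km; have -> : (a m)%:R - (a k)%:R = ((a m)%:Z - (a k)%:Z)%:~R :> rat.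
    by rewrite intrB.
  by rewrite padic_norm_int_le// -eqz_mod_dvd !modz_nat (aE _ _ km).
have ac : (fun n => (a n)%:R) \in padic_cauchy p_pr.
  apply/padic_cauchyP => e e0; have [k ke] := expr_unbounded p_pr e^-1.
  exists k => m n km kn; rewrite -(subrKA (a k)%:R).
  rewrite (le_lt_trans (padic_normD p_pr _ _))// gt_max.
  rewrite (@padic_normB p (a k)%:R); apply/andP.
  by split; rewrite (le_lt_trans (aN _ _ _))// invf_plt ?posrE// exprn_gt0// ltr0n
    prime_gt0.
exists (Qp_of (PadicSeq ac)) => k; rewrite Qp_natr /Qp_rat -rmorphB.
by apply: (@Qp_norm_le _ _ _ _ k) => m km; exact: aN.
Qed.

(** After rescaling, f is trivial on Z_p. Then f(p^-k) is a p^k-th root of unity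
    and thus psi(p^-k)^(a k); taking the p-th power of the relation at k + 1
    shows that the a k are compatible modulo p^k. Their limit w satisfies
    f(p^-k) = psi(w p^-k), because psi does not see the difference of w and
    a k multiplied by p^-k, which lies in Z_p. The elements p^-k generate the
    dense subgroup Z[1/p]. *)
Lemma character_dual psi f : is_character psi ->
  (forall x, Qp_norm x <= 1 -> psi x = 1) ->
  (forall k, (p ^ k).-primitive_root (psi (p%:R ^- k) : R[i])) ->
  is_character f -> exists w, forall x, f x = psi (w * x).
Proof.
move=> psiC psi1 prim fC; have [n fn] := character_locally_trivial fC.
wlog n0 : f fC n fn / n = 0%N => [wl|].
  have gC := character_scale (p%:R ^+ n) fC.
  have [|w wE] := wl _ gC 0%N _ erefl.
    move=> x; rewrite expr0 invr1 => x1; apply: fn.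
    by rewrite Qp_normM Qp_norm_p ler_piMr// invr_ge0 exprn_ge0.
  exists (w / p%:R ^+ n) => x.
  by rewrite -mulrA -wE mulVKf ?Qp_p_neq0.
subst n; have f1 x : Qp_norm x <= 1 -> f x = 1.
  by move=> x1; apply: fn; rewrite expr0 invr1.
have [f0 fD _] := fC; have [psi0 psiD _] := psiC.
have [a aE] : {a : nat -> nat & forall k, f (p%:R ^- k) = psi (p%:R ^- k) ^+ a k}.
  apply: (@choice _ _ (fun k i => f (p%:R ^- k) = psi (p%:R ^- k) ^+ i)) => k.
  have /(prim_rootP (prim k))[i ->] : (f (p%:R ^- k) : R[i]) ^+ (p ^ k) = 1.
    rewrite -character_natmul// natrX divff ?Qp_p_neq0// f1//.
    by have := Qp_norm_nat_le1 p_pr 1.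
  by exists i.
have [w wE] : exists w : Qp, forall k, Qp_norm (w - (a k)%:R) <= p%:R ^- k.
  apply: digit_limit => k; apply/eqP; rewrite -(eq_prim_root_expr (prim k)).
  have pV : p%:R ^- k = p%:R * p%:R ^- k.+1 :> Qp.
    by rewrite exprS invfM mulrA divff ?mul1r// -[p%:R]expr1 Qp_p_neq0.
  by rewrite -aE {1 2}pV !character_natmul// -exprM mulnC exprM -aE.
have fp k : f (p%:R ^- k) = psi (w * p%:R ^- k).
  rewrite -[w](subrK (a k)%:R) mulrDl psiD character_natmul// -aE psi1 ?mul1r//.
  rewrite Qp_normM Qp_norm_pV -ler_pdivlMr ?mul1r//.
  by rewrite exprn_gt0// ltr0n prime_gt0.
exists w; apply/funeqP.
have gC := character_scale w psiC; have [g0 gD cg] := gC.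
have [_ _ cf] := fC.
apply: (@extension_unique R p p_pr Qp (@Qp_emb_dense p p_pr) (f \o emb)).
  by split.
split=> [|||t]; [exact: g0|exact: gD|exact: cg|].
have [k [m ->]] := Hplus_fracP t.
by rewrite /= Qp_emb_frac mulrCA !character_natmul// fp.
Qed.

End StandardCharacter.

(** * The action at the place p *)

Section PadicAction.
Variables (R : realType) (p : nat) (p_pr : prime p).
Local Notation C := R[i]^o.
Local Notation Qp := (Qp p_pr).
Local Notation emb := (Hplus_emb (p_pr := p_pr) Qp).
Local Notation points := (localPoints R p_pr Qp).
Implicit Types (w : multGroup Qp) (rho : points).

(** Let rho0 be trivial on the ball of radius p^-n. The points rho close to rho0
    on the compact set of [compact_powers] are trivial on the same ball, and
    (w - w0) x lies in it for all x in A when w is close to w0. Then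
    rho(w x) = rho(w0 x), and closeness on the compact set w0 A concludes. *)
Lemma scaled_extension_continuous (act : multGroup Qp -> points -> points) :
  (forall w rho, extension (act w rho) = (fun x => extension rho (val w * x))) ->
  continuous (fun ux : multGroup Qp * points => act ux.1 ux.2).
Proof.
move=> actE [w0 rho0]; apply: cvg_points => A e cA e0; rewrite actE /=.
have [n fn] := character_locally_trivial (extension_character rho0).
have c0 : 0 < (2 * p%:R)^-1 :> R by rewrite invr_gt0 mulr_gt0// ltr0n prime_gt0.
have cwA : compact ((fun x : Qp => val w0 * x) @` A).
  apply: continuous_compact cA; apply: continuous_subspaceT.
  exact: Qp_mul_continuous.
have near_rho1 := near_points rho0 cwA e0.
have near_rho2 := near_points rho0 (@compact_powers p p_pr n) c0.
have near_w : \forall w \near w0, forall x, A x ->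
    Qp_norm ((val w - val w0) * x) <= p%:R ^- n.
  have cv : (val w : Qp) @[w --> w0] --> (val w0 : Qp) by exact: initial_continuous.
  have /compact_near_coveringP cover := cA.
  apply: (cover _ (nbhs w0)
    (fun w x => Qp_norm ((val w - val w0) * x) <= p%:R ^- n)) => x Ax.
  have [m xm] := expr_unbounded p_pr (Qp_norm x).
  (* every y within 1 of x has norm at most p^m *)
  exists ([set y | Qp_norm (x - y) <= p%:R ^- 0],
          [set w | Qp_norm (val w0 - val w) <= p%:R ^- (n + m)]) => /=.
    split; first by apply/near_QpP; exists 0%N.
    have nb : nbhs (val w0 : Qp) [set y | Qp_norm (val w0 - y) <= p%:R ^- (n + m)].
      by apply/near_QpP; exists (n + m)%N.
    exact: (cv _ nb).
  move=> -[y w] /= [xy ww].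
  have ym : Qp_norm y <= p%:R ^+ m.
    rewrite -[y](subKr x); apply: Qp_norm_le_max; first exact: ltW.
    rewrite Qp_normN (le_trans xy)// expr0 invr1.
    by rewrite exprn_ege1// ler1n prime_gt0.
  rewrite Qp_normM Qp_normB.
  apply: le_trans (ler_pM (Qp_norm_ge0 _) (Qp_norm_ge0 _) ww ym) _.
  by rewrite exprD invfM -mulrA mulVf ?pnat_neq0// mulr1.
apply: (@filterS3 _ _ (nbhs_filter (w0, rho0)) _ _ _ _ _
  (cvg_fst near_w) (cvg_snd near_rho1) (cvg_snd near_rho2)).
move=> -[w rho] /= hw h1 h2 x Ax; rewrite actE.
have fC := extension_character rho; have [f0 fD _] := fC.
have triv : forall y, Qp_norm y <= p%:R ^- n -> extension rho y = 1.
  apply: character_trivial_ball => //; apply: character_near1 => // k nk.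
  rewrite normcB -(fn (p%:R ^+ k)); first by apply: h2; right; exists k.
  rewrite Qp_norm_p lef_pV2 ?posrE ?exprn_gt0 ?ltr0n ?prime_gt0//.
  by rewrite ler_weXn2l// ler1n prime_gt0.
have -> : extension rho (val w * x) = extension rho (val w0 * x).
  by rewrite -[val w](subrK (val w0)) mulrDl fD triv ?mul1r// hw.
by apply: h1; exists x.
Qed.

(** By [character_dual] every point is psi(w x) for some w, which is unique
    because psi is non-trivial and Q_p is a field; this gives the bijection with
    the Weil group. *)
Lemma padic_action : exists act : multGroup Qp -> points -> points,
  [/\ continuous_action act,
      extends_frobenius act,
      (forall w rho t, val (act w rho) t = extension rho (val w * emb t))
    & principal_homogeneous act].
Proof.
have [psi [psiC psi1 prim]] := standard_character R p_pr.
have [psi0 psiD _] := psiC.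
have psi_neq1 : exists x, psi x != 1.
  exists (p%:R ^- 1); have := prim 1%N; rewrite expn1 => /prim_order_dvd/(_ 1%N).
  by rewrite expr1 dvdn1 => <-; rewrite gtn_eqF// prime_gt1.
have faithful (u v : Qp) : (forall x, psi (u * x) = psi (v * x)) -> u = v.
  move=> uv; apply/eqP; rewrite -subr_eq0; apply: contraT => uv0.
  have [x] := psi_neq1; rewrite -(mulVKf uv0 x) mulrBl psiD uv.
  by rewrite -psiD addrN (character0 psi0 psiD) eqxx.
have [h hE] : {h : multGroup Qp -> points &
    forall w, is_extension (val (h w)) (fun x => psi (val w * x))}.
  apply: (@choice _ _ (fun w (rho : points) =>
    is_extension (val rho) (fun x => psi (val w * x)))) => w.
  have gC := character_scale (val w) psiC; have [g0 gD cg] := gC.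
  have ne : (fun x => psi (val w * x)) \o emb <> cst 1.
    move=> g1; have : (fun x => psi (val w * x)) = cst 1.
      apply: (@extension_unique R p p_pr Qp (@Qp_emb_dense p p_pr) (cst 1)).
        by split=> // t; exact: (congr1 (@^~ t) g1).
      split=> [x|x y|x|//]; [exact: oner_neq0|by rewrite /= mulr1|exact: cst_continuous].
    move/funeqP => w1; have := valP w; rewrite (_ : val w = 0) ?eqxx//.
    by apply: faithful => x; rewrite w1 mul0r (character0 psi0 psiD).
  have [rho _ rhoE] := point_character (Qp_emb0 p_pr) (@Qp_embD p p_pr) g0 gD cg ne.
  by exists rho.
have extE rho w : is_extension (val rho) (fun x => psi (val w * x)) ->
    extension rho = (fun x => psi (val w * x)).
  exact: (extensionE (@Qp_emb_dense p p_pr)).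
have [e eE] : {e : points -> multGroup Qp &
    forall rho, extension rho = (fun x => psi (val (e rho) * x))}.
  apply: (@choice _ _ (fun rho (w : multGroup Qp) =>
    extension rho = (fun x => psi (val w * x)))) => rho.
  have [w wE] := character_dual psiC psi1 prim (extension_character rho).
  have w0 : w != 0.
    have [_ _] := pointP rho; apply: contra_notN => /eqP w0; apply/funext => t.
    have [_ _ _ <-] := padic_extensionP rho.
    by rewrite wE w0 mul0r (character0 psi0 psiD).
  by exists (Sub w w0); apply/funext.
have hK : cancel h e.
  move=> w; apply/val_inj/faithful => x.
  by have := extE _ _ (hE w); rewrite eE => /funeqP/(_ x).
have eK : cancel e h.
  move=> rho; apply/val_inj/funext => t.
  have [_ _ _ <-] := hE (e rho); have [_ _ _ <-] := padic_extensionP rho.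
  by rewrite eE.
have [act1 actM torsor] := transported_torsor eK hK.
have actE w rho :
    extension (h (w * e rho)%g) = (fun x => extension rho (val w * x)).
  rewrite (extE _ _ (hE _)) eE; apply/funext => x; congr psi.
  by rewrite mulrA [X in X * _]mulrC.
have actV w rho t : val (h (w * e rho)%g) t = extension rho (val w * emb t).
  by have [_ _ _ <-] := padic_extensionP (h (w * e rho)%g); rewrite actE.
exists (fun w rho => h (w * e rho)%g); split=> //.
- split=> //.
  exact: (@scaled_extension_continuous (fun w rho => h (w * e rho)%g)) actE.
- move=> n n0; have nQ : n%:R != 0 :> Qp.
    by rewrite Qp_natr fmorph_eq0 pnatr_eq0 -lt0n.
  exists (Sub n%:R nQ) => // rho; apply/funext => t; rewrite actV.
  have [f0 fD _] := extension_character rho.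
  rewrite [val _]/= character_natmul// /frobenius.
  by have [_ _ _ <-] := padic_extensionP rho.
Qed.

Lemma padic_extension_unique rho : exists! f : Qp -> C, is_extension (val rho) f.
Proof.
exists (extension rho); split=> [|f fE]; first exact: padic_extensionP.
exact: (extension_unique (@Qp_emb_dense p p_pr) (padic_extensionP rho) fE).
Qed.

End PadicAction.

(** * The theorem *)

Theorem theorem3 (R : realType) (p : nat) (p_pr : prime p) :
  [/\ (forall rho : localPoints R p_pr R^o,
         exists! f : R^o -> R[i]^o, is_extension (val rho) f),
      (forall rho : localPoints R p_pr R^o,
         exists! z : multGroup R[i]^o,
           forall t, val rho t = cexp (val z * ratr (val t)))
    & exists act : multGroup R[i]^o ->
                   localPoints R p_pr R^o -> localPoints R p_pr R^o,
        [/\ continuous_action act,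
            extends_frobenius act,
            (forall (w z : multGroup R[i]^o) (rho : localPoints R p_pr R^o),
               (forall t, val rho t = cexp (val z * ratr (val t))) ->
               forall t, val (act w rho) t
                         = cexp (val w * val z * ratr (val t)))
          & principal_homogeneous act]]
  /\
  [/\ (forall rho : localPoints R p_pr (Qp p_pr),
         exists! f : Qp p_pr -> R[i]^o, is_extension (val rho) f)
    & exists act : multGroup (Qp p_pr) ->
                   localPoints R p_pr (Qp p_pr) -> localPoints R p_pr (Qp p_pr),
        [/\ continuous_action act,
            extends_frobenius act,
            (forall (w : multGroup (Qp p_pr))
                    (rho : localPoints R p_pr (Qp p_pr)) t,
               val (act w rho) t = extension rho (val w * Hplus_emb (Qp p_pr) t))
          & principal_homogeneous act]].
Proof.
split; split.
- exact: real_extension_unique.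
- exact: real_point_exp_unique.
- exact: real_action.
- exact: padic_extension_unique.
- exact: padic_action.
Qed.
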